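(* Let the data $A,B_1,B_2,C,D$ and $F_1,\dots,F_M$ satisfy the two standing assumptions in the context, and let $\widehat\varphi_1,\widehat\varphi_2,\zeta$ be as defined there. Let $\{(u_k,v_k,s_{2;k})\}_{k\ge0}$ be a sequence in $\mathbb{R}^{mn}\times\mathbb{R}^{mn}\times\mathbb{R}^{mn}$ generated by the Douglas–Rachford splitting iteration $$u_k\in\mathbf{prox}_{\eta\widehat\varphi_1}(s_{2;k}),\qquad v_k\in\mathbf{prox}_{\eta\widehat\varphi_2}(2u_k-s_{2;k}),\qquad s_{2;k+1}=s_{2;k}+\xi(v_k-u_k),$$ with $\eta,\xi>0$. Assume that the sequences $\{u_k\}_{k\ge0}$ and $\{s_{2;k}\}_{k\ge0}$ are contained in a closed convex set $\mathcal{S}^*\subseteq\mathrm{dom}(\widehat\varphi_1)$ such that $\widehat\varphi_1$ is $L_{\widehat\varphi_1}$-smooth on $\mathcal{S}^*$. Suppose that $$\xi\in(0,2)\quad\text{and}\quad\eta<\min\Big\{\frac{2-\xi}{2L_{\widehat\varphi_1}},\ \frac1{L_{\widehat\varphi_1}}\Big\}.$$ Then the sequences $\{u_k\}_{k\ge0}$ and $\{v_k\}_{k\ge0}$ converge to the same limit $u'$, which satisfies $0\in\partial\zeta(u')$.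
   Context: Data. $A\in\mathbb{R}^{n\times n}$, $B_2\in\mathbb{R}^{n\times m}$, $B_1\in\mathbb{R}^{n\times l}$, $C\in\mathbb{R}^{q\times n}$, $D\in\mathbb{R}^{q\times m}$ are the matrices of the system $\dot x=Ax+B_2u+B_1w$, $z=Cx+Du$; $p=m+n$; $\gamma>0$. Partitions $m=m_1+\dots+m_s$ and $n=n_1+\dots+n_t$ are fixed. Standing assumption 1: $C^\top D=0$, $D^\top D\succ0$, $C^\top C\succ0$, $B_1B_1^\top\succ0$, $(A,B_2)$ is stabilizable, and $(A,C)$ has no unobservable modes on the imaginary axis. Standing assumption 2: $F=\begin{pmatrix}A&-B_2\\0&0\end{pmatrix}\in\mathbb{R}^{p\times p}$ is unknown but is a convex combination $F=\sum_{i=1}^M\xi_iF_i$, $\xi_i\ge0$, $\sum_i\xi_i=1$, of given matrices $F_i=\begin{pmatrix}A_i&-B_{2,i}\\0&0\end{pmatrix}\in\mathbb{R}^{p\times p}$ (the weights $\xi_i$ are unrelated to the relaxation parameter $\xi$). Matrices: $Q=\begin{pmatrix}B_1B_1^\top&0\\0&0\end{pmatrix}$, $R=\begin{pmatrix}C^\top C&0\\0&D^\top D\end{pmatrix}\in\mathbb{S}^p$, $V_1=[\mathbf 0_{m\times n},I_m]$, $V_2=[I_n,\mathbf 0_{n\times m}]$. For $W\in\mathbb{R}^{p\times p}$ let $W_1$ denote its leading $n\times n$ block, partitioned into blocks of size $n_a\times n_b$. With $N=t(t-1)/2$, the matrices $V_{j1},V_{j2}$ ($j\in[N]$) are the $0$-$1$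 selection matrices such that $V_{j1}WV_{j2}$, $j\in[N]$, enumerates the blocks $(W_1)_{ab}$, $1\le a<b\le t$. Set $$\widehat{\mathcal A}=\begin{pmatrix} V_{12}^\top\otimes V_{11} \\ \vdots \\ V_{N2}^\top\otimes V_{N1} \end{pmatrix}\in\mathbb{R}^{N^*\times p^2},\quad \mathcal{A}=\begin{pmatrix} \widehat{\mathcal A} \\ V_2\otimes V_1 \end{pmatrix}\in\mathbb{R}^{(N^*+mn)\times p^2},\quad U=\begin{pmatrix} \mathbf 0_{N^*\times mn} \\ I_{mn} \end{pmatrix},$$ where $N^*=\sum_{a<b}n_an_b$ is the number of rows of $\widehat{\mathcal A}$. Functions: $\mathrm{vec}$ stacks columns; $\mathbb{S}^k_+$ is the set of symmetric positive semidefinite $k\times k$ matrices; $\Gamma_+^k=\{\mathrm{vec}(X):X\in\mathbb{S}_+^k\}$; $\delta_S$ is the indicator function of $S$. For $\widetilde W=\mathrm{vec}(W)\in\mathbb{R}^{p^2}$ let $\widetilde\Psi_i=\mathrm{vec}\big(-V_2(F_iW+WF_i^\top+Q)V_2^\top\big)$, and $$f(\widetilde W)=\langle\mathrm{vec}(R),\widetilde W\rangle+\delta_{\Gamma_+^p}(\widetilde W)+\sum_{i=1}^M\delta_{\Gamma_+^n}(\widetilde\Psi_i).$$ For $s_2=\mathrm{vec}(P)\in\mathbb{R}^{mn}$ with $P\in\mathbb{R}^{m\times n}$ partitioned into blocks $P_{ij}\in\mathbb{R}^{m_i\times n_j}$, $\pi(s_2)\in\{0,1\}^{st}$ has entry with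 index $i+s(j-1)$ equal to $1$ if $P_{ij}\ne0$ and $0$ if $P_{ij}=0$; $\|\cdot\|_0$ counts nonzero entries. For $s_2\in\mathbb{R}^{mn}$ define $$\widehat\varphi_1(s_2)=\inf\{f(\widetilde W):\mathcal{A}\widetilde W=Us_2\},\qquad\widehat\varphi_2(s_2)=\gamma\|\pi(s_2)\|_0,\qquad\zeta=\widehat\varphi_1+\widehat\varphi_2 .$$ $\mathbf{prox}_{\tau\phi}(z)=\operatorname{argmin}_y\{\phi(y)+\frac1{2\tau}\|y-z\|^2\}$ (a set in general). A function is $L$-smooth on a set if it is differentiable at every point of the set and its gradient is $L$-Lipschitz on the set. $\mathrm{dom}$ is the effective domain; $\partial$ is the limiting (Mordukhovich) subdifferential. *)

(* Defs.v *)
(* MathComp-Analysis; complex numbers from mathcomp-real-closed. *)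
From HB Require Import structures.
From mathcomp Require Import all_boot all_order all_algebra.
From mathcomp Require Import all_classical all_reals all_analysis.
From mathcomp Require Import complex mxtens.

Set Implicit Arguments.
Unset Strict Implicit.
Unset Printing Implicit Defensive.

Import Order.TTheory GRing.Theory Num.Theory.
Import numFieldNormedType.Exports.

Local Open Scope classical_set_scope.
Local Open Scope ring_scope.

Notation "A *t B" := (tensmx A B)
  (at level 40, left associativity, format "A  *t  B") : ring_scope.

Section Vectorization.
Context {R : realType}.

(* Column stacking: entry (i, j) of X sits at (0-based) position j * m + i, the
   pair convention of the Kronecker product of mxtens.  The library's mxvec
   stacks rows. *)
Definition vec {m n} (X : 'M[R]_(m, n)) : 'cV[R]_(n * m) :=
  \col_k X (mxtens_unindex k).2 (mxtens_unindex k).1.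

Definition unvec {m n} (x : 'cV[R]_(n * m)) : 'M[R]_(m, n) :=
  \matrix_(i, j) x (mxtens_index (j, i)) 0.

Lemma vecK m n : cancel (@vec m n) unvec.
Proof. by move=> X; apply/matrixP => i j; rewrite !mxE mxtens_indexK. Qed.

Lemma unvecK m n : cancel unvec (@vec m n).
Proof.
by move=> x; apply/colP => k; case: (mxtens_indexP k) => i j;
  rewrite !mxE mxtens_indexK.
Qed.

Lemma vec_mulmx m n p q (A : 'M[R]_(p, m)) (X : 'M[R]_(m, n))
  (B : 'M[R]_(n, q)) : vec (A *m X *m B) = (B^T *t A) *m vec X.
Proof.
apply/colP => k; case: (mxtens_indexP k) => i j.
rewrite !mxE mxtens_indexK /=.
transitivity (\sum_b \sum_a B b i * A j a * X a b).
  apply: eq_bigr => b _; rewrite mxE big_distrl /=; apply: eq_bigr => a _.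
  by rewrite mulrC mulrA.
rewrite pair_big /=.
rewrite (reindex (@mxtens_unindex n m)) /=; last first.
  by exists (@mxtens_index n m) => l _; rewrite (mxtens_indexK, mxtens_unindexK).
by apply: eq_bigr => l _; rewrite !mxE mxtens_indexK.
Qed.

Definition inner {k} (x y : 'cV[R]_k) : R := \sum_i x i 0 * y i 0.

(* Euclidean norm; the library norm on matrices is the maximum norm. *)
Definition enorm {k} (x : 'cV[R]_k) : R := Num.sqrt (inner x x).

Definition l0norm {k} (x : 'cV[R]_k) : nat := #|[set i | x i 0 != 0]%SET|.

Definition possemidef {k} (X : 'M[R]_k) : Prop :=
  X^T = X /\ forall x : 'cV[R]_k, 0 <= inner x (X *m x).

Definition posdef {k} (X : 'M[R]_k) : Prop :=
  X^T = X /\ forall x : 'cV[R]_k, x != 0 -> 0 < inner x (X *m x).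

Definition Gamma_plus k : set 'cV[R]_(k * k) := [set vec X | X in @possemidef k].

End Vectorization.
Arguments Gamma_plus {R} k.

Section Control.
Context {R : realType}.
Local Notation toC := (map_mx (real_complex R)).

Definition hurwitz {n} (A : 'M[R]_n) : Prop :=
  forall z : R[i], eigenvalue (toC A) z -> complex.Re z < 0.

Definition stabilizable {n m} (A : 'M[R]_n) (B : 'M[R]_(n, m)) : Prop :=
  exists K : 'M[R]_(m, n), hurwitz (A + B *m K).

Definition unobservable_mode {n q} (A : 'M[R]_n) (C : 'M[R]_(q, n)) (z : R[i])
    : Prop :=
  exists2 x : 'cV[R[i]]_n, x != 0 & toC A *m x = z *: x /\ toC C *m x = 0.

Definition standing_assumption1 {n m l q} (A : 'M[R]_n) (B2 : 'M[R]_(n, m))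
    (B1 : 'M[R]_(n, l)) (C : 'M[R]_(q, n)) (D : 'M[R]_(q, m)) : Prop :=
  [/\ C^T *m D = 0,
      [/\ posdef (D^T *m D), posdef (C^T *m C) & posdef (B1 *m B1^T)],
      stabilizable A B2 &
      forall z : R[i], unobservable_mode A C z -> complex.Re z != 0].

Definition Fmx {n m} (A : 'M[R]_n) (B2 : 'M[R]_(n, m)) : 'M[R]_(n + m) :=
  block_mx A (- B2) 0 0.

Definition standing_assumption2 {n m M} (A : 'M[R]_n) (B2 : 'M[R]_(n, m))
    (F : 'I_M -> 'M[R]_(n + m)) : Prop :=
  exists w : 'I_M -> R,
    [/\ forall i, 0 <= w i, \sum_i w i = 1 & Fmx A B2 = \sum_i w i *: F i].

Definition Qmx {n l} m (B1 : 'M[R]_(n, l)) : 'M[R]_(n + m) :=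
  block_mx (B1 *m B1^T) 0 0 0.

Definition Rmx {n m q} (C : 'M[R]_(q, n)) (D : 'M[R]_(q, m)) : 'M[R]_(n + m) :=
  block_mx (C^T *m C) 0 0 (D^T *m D).

Definition V1 n m : 'M[R]_(m, n + m) := row_mx 0 1%:M.
Definition V2 n m : 'M[R]_(n, n + m) := row_mx 1%:M 0.

End Control.

Section Blocks.
Context {R : realType} {t : nat} (ns : 'I_t -> nat) (m : nat).
Local Notation n := (\sum_j ns j)%N.

Definition upper_pairs : {set 'I_t * 'I_t} := [set ab : 'I_t * 'I_t | (ab.1 < ab.2)%N]%SET.
Definition nb_upper : nat := #|upper_pairs|.

Lemma nb_upperE : nb_upper = (t * (t - 1) %/ 2)%N.
Proof.
rewrite subn1 divn2 -bin2 -bin2_sum big_mkord /nb_upper -sum1dep_card.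
rewrite -(pair_big_dep predT (fun a b : 'I_t => a < b)%N (fun _ _ => 1%N)) /=.
rewrite (exchange_big_dep predT) //=; apply: eq_bigr => b _.
by rewrite (big_ord_narrow (ltnW (ltn_ord b))) sum1_card card_ord.
Qed.

(* Row and column block index of the j-th upper off-diagonal block. *)
Definition blk_row (j : 'I_nb_upper) : 'I_t := (enum_val j).1.
Definition blk_col (j : 'I_nb_upper) : 'I_t := (enum_val j).2.

Definition Vj1 (j : 'I_nb_upper) : 'M[R]_(ns (blk_row j), n + m) :=
  row_mx (submxcol (1%:M : 'M[R]_n) (blk_row j)) 0.

Definition Vj2 (j : 'I_nb_upper) : 'M[R]_(n + m, ns (blk_col j)) :=
  col_mx (submxrow (1%:M : 'M[R]_n) (blk_col j)) 0.

Lemma Vj1_mul_Vj2 (j : 'I_nb_upper) (W : 'M[R]_(n + m)) :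
  Vj1 j *m W *m Vj2 j = submxblock (ulsubmx W) (blk_row j) (blk_col j).
Proof.
rewrite /Vj1 /Vj2 -[W in LHS]submxK mul_row_block !mul0mx !addr0 mul_row_col.
rewrite mulmx0 addr0 submxblockEv mul_submxrow mulmx1.
by rewrite submxcol_mul mul1mx.
Qed.

Definition Ahat :
    'M[R]_(\sum_(j < nb_upper) ns (blk_col j) * ns (blk_row j), (n + m) * (n + m)) :=
  \mxcol_(j < nb_upper) ((Vj2 j)^T *t Vj1 j).

Definition Acal := col_mx Ahat (V2 n m *t V1 n m).

Definition Umx :
    'M[R]_(\sum_(j < nb_upper) ns (blk_col j) * ns (blk_row j) + n * m, n * m) :=
  col_mx 0 1%:M.

End Blocks.

Section Functions.
Context {R : realType}.
Local Open Scope ereal_scope.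

Definition delta {T : Type} (S : set T) (x : T) : \bar R :=
  if `[< S x >] then 0 else +oo.

Definition Psi {n m l} (B1 : 'M[R]_(n, l)) (F : 'M[R]_(n + m))
    (W : 'M[R]_(n + m)) : 'cV[R]_(n * n) :=
  vec (- (V2 n m *m (F *m W + W *m F^T + Qmx m B1) *m (V2 n m)^T))%R.

Definition fobj {n m l q M} (B1 : 'M[R]_(n, l)) (C : 'M[R]_(q, n))
    (D : 'M[R]_(q, m)) (F : 'I_M -> 'M[R]_(n + m))
    (Wt : 'cV[R]_((n + m) * (n + m))) : \bar R :=
  (inner (vec (Rmx C D)) Wt)%:E + delta (Gamma_plus (n + m)%N) Wt
  + \sum_(i < M) delta (Gamma_plus n) (Psi B1 (F i) (unvec Wt)).

Definition phi1hat {t} (ns : 'I_t -> nat) {m l q M}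
    (B1 : 'M[R]_((\sum_j ns j)%N, l)) (C : 'M[R]_(q, (\sum_j ns j)%N))
    (D : 'M[R]_(q, m)) (F : 'I_M -> 'M[R]_((\sum_j ns j) + m)%N)
    (s2 : 'cV[R]_((\sum_j ns j) * m)) : \bar R :=
  ereal_inf [set fobj B1 C D F Wt | Wt in
    [set Wt | Acal ns m *m Wt = Umx ns m *m s2]%R].

Definition pi_blocks {s t} (ms : 'I_s -> nat) (ns : 'I_t -> nat)
    (s2 : 'cV[R]_((\sum_j ns j) * (\sum_i ms i))) : 'cV[R]_(t * s) :=
  vec (\matrix_(i < s, j < t) (submxblock (unvec s2) i j != 0%R)%:R)%R.

Definition phi2hat {s t} (ms : 'I_s -> nat) (ns : 'I_t -> nat) (gamma : R)
    (s2 : 'cV[R]_((\sum_j ns j) * (\sum_i ms i))) : \bar R :=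
  (gamma * (l0norm (pi_blocks s2))%:R)%R%:E.

End Functions.

Section VariationalAnalysis.
Context {R : realType} {k : nat}.
Implicit Types (phi : 'cV[R]_k -> \bar R) (x y z v : 'cV[R]_k).

Definition edom phi : set 'cV[R]_k := [set x | (phi x < +oo)%E].

Definition prox (tau : R) phi z : set 'cV[R]_k :=
  [set y | forall y',
    (phi y + (1 / (2 * tau) * enorm (y - z) ^+ 2)%:E
     <= phi y' + (1 / (2 * tau) * enorm (y' - z) ^+ 2)%:E)%E].

(* An extended-real-valued function is differentiable at x when it is finite
   near x and its real-valued restriction is differentiable at x. *)
Definition ediff phi x : Prop :=
  (\forall y \near x, phi y \is a fin_num) /\ differentiable (fine \o phi) x.

Definition grad phi x : 'cV[R]_k := \col_i 'd (fine \o phi) x (delta_mx i 0).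

Definition Lsmooth_on (L : R) phi (S : set 'cV[R]_k) : Prop :=
  (forall x, S x -> ediff phi x) /\
  (forall x y, S x -> S y ->
    enorm (grad phi x - grad phi y) <= L * enorm (x - y)).

(* Regular (Frechet) subgradients:
   phi y >= phi x + <v, y - x> + o(|y - x|), at a point where phi is finite. *)
Definition reg_subdiff phi x : set 'cV[R]_k :=
  [set v | phi x \is a fin_num /\
    forall e : R, 0 < e -> \forall y \near x,
      (phi x + (inner v (y - x) - e * enorm (y - x))%:E <= phi y)%E].

Definition lim_subdiff phi x : set 'cV[R]_k :=
  [set v | phi x \is a fin_num /\
    exists xs vs : nat -> 'cV[R]_k,
      [/\ xs i @[i --> \oo] --> x,
          phi (xs i) @[i --> \oo] --> phi x,
          (forall i, reg_subdiff phi (xs i) (vs i)) &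
          vs i @[i --> \oo] --> v]].

Definition DR_iterates (eta xi : R) (phi1 phi2 : 'cV[R]_k -> \bar R)
    (u v s2 : nat -> 'cV[R]_k) : Prop :=
  forall i, [/\ prox eta phi1 (s2 i) (u i),
                prox eta phi2 (2 *: u i - s2 i) (v i) &
                s2 i.+1 = s2 i + xi *: (v i - u i)].

End VariationalAnalysis.

(* Main.v *)
Require Import Defs.
From mathcomp Require Import all_boot all_order all_algebra.
From mathcomp Require Import all_classical all_reals all_analysis.
From mathcomp Require Import mxtens.
From mathcomp Require Import ring lra.

Set Implicit Arguments.
Unset Strict Implicit.

Import Order.TTheory GRing.Theory Num.Theory.
Import numFieldNormedType.Exports.
Local Open Scope classical_set_scope.
Local Open Scope ring_scope.

(** Write [G] for the gradient of the first function [phi1], so that the first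
    proximal step reads [s = u + eta G u], and put [r = v - u]. The second
    proximal step is applied at [z = u - eta G u], and [v - z = r + eta G u].
    Since the penalty only sees which blocks vanish, [v] is the orthogonal
    projection of [z] on the coordinate subspace of its own nonzero blocks
    ([prox_sparsity_orth]), and each of these blocks has norm at least
    [sqrt (2 eta gamma)] ([prox_sparsity_gap]).

    The definition of [phi1] by partial minimization over linear matrix
    inequalities enters through two facts: [phi1] is convex ([value_convex]) and
    it grows at least linearly ([value_coercive]). The latter holds because the
    cost matrix is positive definite, so that the cost of a positive
    semidefinite matrix controls its entries.

    The iterates are bounded ([DR_bounded_s]): up to the bounded perturbation
    [v - z], orthogonal to [v], the sequence [s] follows a relaxed gradient
    descent on the Moreau envelope of [phi1]. Along the iteration the
    Douglas-Rachford envelope decreases by at least a constant times the squared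
    increment of [u] ([merit_decrease]; this is where the bound on [eta]
    enters) and, the iterates being bounded, it is bounded below. Hence the
    increments of [u] and the residuals [r] tend to [0].

    The increments of [v] then also tend to [0], so the gap above forces the set
    of nonzero blocks of [v] to become constant ([pattern_stationary]). From
    then on the second proximal step is the projection on a fixed subspace, and
    the iteration is Fejer monotone with respect to the point [u' + eta G u']
    given by any cluster point [u'] of [u]; so the whole sequence converges
    ([DR_limit]).

    Passing to the limit in the second proximal step and adding the gradient
    inequality of [phi1] shows that [zeta w >= zeta u' - |w - u'|^2 / (2 eta)]
    for all [w], so [0] is a regular, hence limiting, subgradient at [u']
    ([DR_sparsity_cvg]). *)

(** * The Euclidean inner product *)

Section Euclid.
Context {R : realType} {k : nat}.
Implicit Types (x y z : 'cV[R]_k) (a c : R).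

Lemma innerC x y : inner x y = inner y x.
Proof. by apply: eq_bigr => i _; rewrite mulrC. Qed.

Lemma innerDl x y z : inner (x + y) z = inner x z + inner y z.
Proof. by rewrite -big_split; apply: eq_bigr => i _; rewrite mxE mulrDl. Qed.

Lemma innerZl a x y : inner (a *: x) y = a * inner x y.
Proof. by rewrite mulr_sumr; apply: eq_bigr => i _; rewrite mxE mulrA. Qed.

Lemma innerNl x y : inner (- x) y = - inner x y.
Proof. by rewrite -scaleN1r innerZl mulN1r. Qed.

Lemma innerDr x y z : inner z (x + y) = inner z x + inner z y.
Proof. by rewrite innerC innerDl !(innerC z). Qed.

Lemma innerZr a x y : inner y (a *: x) = a * inner y x.
Proof. by rewrite innerC innerZl innerC. Qed.

Lemma innerNr x y : inner y (- x) = - inner y x.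
Proof. by rewrite innerC innerNl innerC. Qed.

Definition innerE := (innerDl, innerDr, innerNl, innerNr, innerZl, innerZr).

Lemma inner0l x : inner 0 x = 0.
Proof. by rewrite -(scale0r 0) innerZl mul0r. Qed.

Lemma inner_ge0 x : 0 <= inner x x.
Proof. by apply: sumr_ge0 => i _; rewrite -expr2 sqr_ge0. Qed.

Lemma enorm_ge0 x : 0 <= enorm x.
Proof. exact: sqrtr_ge0. Qed.

Lemma enorm_sqr x : enorm x ^+ 2 = inner x x.
Proof. by rewrite sqr_sqrtr ?inner_ge0. Qed.

Lemma enormN x : enorm (- x) = enorm x.
Proof. by rewrite /enorm innerNl innerNr opprK. Qed.

Lemma enormZ a x : enorm (a *: x) = `|a| * enorm x.
Proof.
by rewrite /enorm innerZl innerZr mulrA -expr2 sqrtrM ?sqr_ge0// sqrtr_sqr.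
Qed.

Lemma enorm_le x a : 0 <= a -> inner x x <= a ^+ 2 -> enorm x <= a.
Proof.
by move=> a0 xa; rewrite -ler_sqr ?nnegrE ?enorm_ge0// enorm_sqr.
Qed.

Lemma coord_le_enorm x i : `|x i 0| <= enorm x.
Proof.
rewrite -(sqrtr_sqr (x i 0)) ler_wsqrtr// /inner (bigD1 i)//= expr2 lerDl.
by apply: sumr_ge0 => j _; rewrite -expr2 sqr_ge0.
Qed.

Lemma enorm_le0 x : enorm x <= 0 -> x = 0.
Proof.
move=> x0; apply/colP => i; rewrite mxE; apply/eqP; rewrite -normr_le0.
exact: le_trans (coord_le_enorm _ _) x0.
Qed.

Lemma cauchy_schwarz x y : inner x y <= enorm x * enorm y.
Proof.
have [/enorm_le0 ->|x0] := leP (enorm x) 0.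
  by rewrite inner0l mulr_ge0 ?enorm_ge0.
have [/enorm_le0 ->|y0] := leP (enorm y) 0.
  by rewrite innerC inner0l mulr_ge0 ?enorm_ge0.
have := inner_ge0 (enorm y *: x - enorm x *: y).
rewrite !innerE -(enorm_sqr x) -(enorm_sqr y) (innerC y x) => h.
have : 0 <= 2 * (enorm x * enorm y) * (enorm x * enorm y - inner x y) by lra.
by rewrite pmulr_rge0 ?subr_ge0// !mulr_gt0.
Qed.

Lemma abs_inner_le x y : `|inner x y| <= enorm x * enorm y.
Proof.
rewrite ler_norml cauchy_schwarz andbT lerNl -innerNl.
by rewrite (le_trans (cauchy_schwarz _ _))// enormN.
Qed.

Lemma enormD x y : enorm (x + y) <= enorm x + enorm y.
Proof.
apply: enorm_le; first by rewrite addr_ge0 ?enorm_ge0.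
rewrite !innerE (innerC y x) -(enorm_sqr x) -(enorm_sqr y).
by have := cauchy_schwarz x y; lra.
Qed.

Lemma enormB x y : enorm (x - y) <= enorm x + enorm y.
Proof. by rewrite (le_trans (enormD _ _)) ?enormN. Qed.

Lemma enorm_le_sum x : enorm x <= \sum_i `|x i 0|.
Proof.
apply: enorm_le; first by apply: sumr_ge0 => i _.
rewrite expr2 mulr_suml; apply: ler_sum => i _.
rewrite -expr2 -real_normK ?num_real// expr2 ler_wpM2l//.
by rewrite (bigD1 i)//= lerDl; apply: sumr_ge0.
Qed.

Lemma enorm_lt x e : 0 < e -> (forall i, `|x i 0| < e / k.+1%:R) -> enorm x < e.
Proof.
move=> e0 xe; apply: (le_lt_trans (enorm_le_sum x)).
have -> : e = \sum_(i < k.+1) e / k.+1%:R.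
  by rewrite sumr_const card_ord -[RHS]mulr_natr divfK// pnatr_eq0.
by rewrite big_ord_recr/= ltr_pwDr ?divr_gt0 ?ler_sum// => i _; exact/ltW/xe.
Qed.

Lemma nbhs_enormP x (P : set 'cV[R]_k) :
  nbhs x P <-> exists2 e, 0 < e & forall y, enorm (y - x) < e -> P y.
Proof.
split=> [/nbhs_ballP[e /= e0 xP]|[e e0 xP]].
  exists e => // y yx; apply: xP; split=> // i j; rewrite ord1.
  rewrite /ball/= distrC; apply: le_lt_trans yx.
  by have := coord_le_enorm (y - x) i; rewrite !mxE.
have e1 : 0 < e / k.+1%:R by rewrite divr_gt0.
apply/nbhs_ballP; exists (e / k.+1%:R) => //= y [_ xy]; apply: xP.
by apply: enorm_lt => // i; rewrite !mxE distrC; exact: xy.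
Qed.

Lemma cvg_enorm (xs : nat -> 'cV[R]_k) x :
  xs n @[n --> \oo] --> x <-> enorm (xs n - x) @[n --> \oo] --> (0 : R).
Proof.
split=> [xsx|xsx].
  apply/cvgrPdist_lt => e e0; near=> n.
  rewrite sub0r normrN ger0_norm ?enorm_ge0//.
  near: n; apply: (xsx [set y | enorm (y - x) < e]).
  by apply/nbhs_enormP; exists e.
move=> P /nbhs_enormP[e e0 xP].
near=> n; apply: xP; near: n.
move/cvgrPdist_lt: xsx => /(_ e e0); apply: filterS => n.
by rewrite sub0r normrN ger0_norm ?enorm_ge0.
Unshelve. all: by end_near. Qed.

Lemma cvg_inner (xs ys : nat -> 'cV[R]_k) x y :
  xs n @[n --> \oo] --> x -> ys n @[n --> \oo] --> y ->
  inner (xs n) (ys n) @[n --> \oo] --> inner x y.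
Proof.
move=> xsx ysy; rewrite /inner; apply: cvg_big => [|i _]; first exact: add_continuous.
have coord z (zs : nat -> 'cV[R]_k) :
    zs n @[n --> \oo] --> z -> zs n i 0 @[n --> \oo] --> z i 0.
  by move=> zsz; exact: continuous_cvg (@coord_continuous _ _ _ i 0 z) zsz.
by apply: cvgM; exact: coord.
Qed.

Lemma bolzano_weierstrass (xs : nat -> 'cV[R]_k) M :
  (forall n, enorm (xs n) <= M) ->
  exists x (sigma : nat -> nat),
    (forall n, (n <= sigma n)%N) /\ xs (sigma n) @[n --> \oo] --> x.
Proof.
move=> xsM.
have cptA : compact [set v : 'rV[R]_k | forall i, `[- M, M]%classic (v ord0 i)].
  by apply: (@rV_compact _ _ (fun=> `[- M, M]%classic)) => _; exact: segment_compact.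
have [] := cptA ((xs n)^T @[n --> \oo]) _.
  exists 0%N => // n _ i /=; rewrite mxE in_itv/= -ler_norml.
  exact: le_trans (coord_le_enorm _ _) _.
move=> p [_ clp].
have near_p e K : 0 < e -> exists2 n, (K <= n)%N & enorm (xs n - p^T) < e.
  move=> e0; have e1 : 0 < e / k.+1%:R by rewrite divr_gt0.
  have [] := clp [set (xs n)^T | n in [set n | (K <= n)%N]] (ball p (e / k.+1%:R)).
  - by exists K => // n Kn; exists n.
  - exact: nbhsx_ballx.
  move=> _ [[n /= Kn <-] [_ pn]]; exists n => //.
  apply: enorm_lt => // i; rewrite !mxE distrC.
  by have := pn 0 i; rewrite /ball/= mxE.
have sub K : {n : nat | (K <= n)%N /\ enorm (xs n - p^T) < K.+1%:R^-1}.
  by apply: cid; have [|n] := near_p K.+1%:R^-1 K; [rewrite invr_gt0|exists n].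
exists p^T, (fun n => sval (sub n)); split; first by move=> n; case: (svalP (sub n)).
apply/cvg_enorm; apply: (@squeeze_cvgr _ _ _ _ (fun=> 0) (@harmonic R)).
- by near=> n; rewrite enorm_ge0/=; case: (svalP (sub n)) => _ /ltW.
- exact: cvg_cst.
- exact: cvg_harmonic.
Unshelve. all: by end_near. Qed.

End Euclid.

(** * Gradients of convex functions and of proximal points *)

Section Gradient.
Context {R : realType} {k : nat}.
Implicit Types (phi : 'cV[R]_k -> \bar R) (x y h : 'cV[R]_k).

(** Convexity of the epigraph; stated with real upper bounds to avoid sums of
    opposite infinities. *)
Definition convex_epi phi := forall x y (a b t : R),
  (phi x <= a%:E)%E -> (phi y <= b%:E)%E -> 0 <= t <= 1 ->
  (phi ((1 - t) *: x + t *: y)%R <= ((1 - t) * a + t * b)%:E)%E.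

Lemma ediff_fin phi x : ediff phi x -> phi x \is a fin_num.
Proof. by case=> /nbhs_singleton. Qed.

Lemma grad_diff phi x h : inner (grad phi x) h = 'd (fine \o phi) x h.
Proof.
have -> : h = \sum_i h i 0 *: delta_mx i 0.
  by rewrite {1}[h]matrix_sum_delta; apply: eq_bigr => i _; rewrite big_ord1.
rewrite linear_sum /=.
rewrite /inner; apply: eq_bigr => i _; rewrite linearZ/= mxE mulrC; congr (_ * _).
rewrite summxE (bigD1 i)//= !mxE !eqxx mulr1 big1 ?addr0// => j ji.
by rewrite !mxE eq_sym (negbTE ji) mulr0.
Qed.

(** The definition of the derivative along a half-line, without division. *)
Lemma grad_line phi x h e : ediff phi x -> 0 < e ->
  exists2 d, 0 < d & forall t, 0 < t -> t < d ->
    phi (x + t *: h) \is a fin_num /\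
    `|fine (phi (x + t *: h)) - fine (phi x) - t * inner (grad phi x) h| <= t * e.
Proof.
move=> [/nbhs_enormP[d1 d10 fin1] df] e0.
have dh : derivable (fine \o phi) x h by exact: diff_derivable.
move/cvgrPdist_le/(_ _ e0): dh.
rewrite -[lim _]/('D_h (fine \o phi) x) deriveE// -grad_diff.
case=> d2 /= d20 H.
have n0 : 0 < enorm h + 1 by rewrite ltr_wpDl ?enorm_ge0.
exists (Num.min d2 (d1 / (enorm h + 1))); first by rewrite lt_min d20 divr_gt0.
move=> t t0; rewrite lt_min => /andP[td2 td1]; split.
  apply: fin1; rewrite addrAC subrr add0r enormZ gtr0_norm//.
  move: td1; rewrite ltr_pdivlMr// => /(le_lt_trans _); apply.
  by rewrite (ler_wpM2l (ltW t0))// lerDl.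
have := H t; rewrite /ball_/= sub0r normrN gtr0_norm// => /(_ td2 (lt0r_neq0 t0)).
rewrite distrC [t *: h + x]addrC -(ler_pM2l t0); apply: le_trans.
rewrite -[X in X * `|_|](gtr0_norm t0) -normrM mulrBr.
have -> // : t * (t^-1 * (fine (phi (x + t *: h)) - fine (phi x))) =
  fine (phi (x + t *: h)) - fine (phi x).
by rewrite mulrA mulfV ?mul1r ?lt0r_neq0.
Qed.

(** Only the value at [y] is bounded: [phi] may be infinite away from [x], and
    the chord from [x] to [y] is used only near [x]. *)
Lemma convex_grad_le phi x y b : convex_epi phi -> ediff phi x ->
  (phi y <= b%:E)%E -> fine (phi x) + inner (grad phi x) (y - x) <= b.
Proof.
move=> cphi dx yb; apply/ler_addgt0Pr => e e0.
have [d d0 H] := grad_line (y - x) dx e0.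
pose t := Num.min (d / 2) 1.
have t0 : 0 < t by rewrite lt_min divr_gt0//=.
have td : t < d by rewrite gt_min ltr_pdivrMr// mulr_natr mulr2n ltrDl d0.
have t1 : t <= 1 by rewrite ge_min lexx orbT.
have [fin /ler_normlP[H1 _]] := H t t0 td.
have := cphi x y (fine (phi x)) b t; rewrite fineK ?ediff_fin//.
move=> /(_ (lexx _) yb); rewrite (ltW t0) t1 => /(_ isT).
have -> : (1 - t) *: x + t *: y = x + t *: (y - x).
  by rewrite scalerBl scale1r scalerBr addrAC addrA.
rewrite -(fineK fin) lee_fin => H2.
by rewrite -(ler_pM2l t0); lra.
Qed.

(** The first-order condition of the proximal problem. Its slope in a direction
    [h] is nonnegative; [h] is then taken opposite to the residual. *)
Lemma prox_grad phi eta z u : 0 < eta -> ediff phi u -> prox eta phi z u ->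
  z = u + eta *: grad phi u.
Proof.
move=> eta0 du puz.
set g := grad phi u.
suff H h : 0 <= inner (u + eta *: g - z) h.
  have le0 : enorm (u + eta *: g - z) <= 0.
    by apply: enorm_le => //; rewrite expr0n -oppr_ge0 -innerNr.
  by apply/esym/eqP; rewrite -subr_eq0; apply/eqP/enorm_le0.
apply/ler_addgt0Pr => e e0.
have e1 : 0 < e / eta / 2 by rewrite !divr_gt0.
have [d d0 H] := grad_line h du e1.
pose t := Num.min (d / 2) (e / (inner h h + 1)).
have n0 : 0 < inner h h + 1 by rewrite ltr_wpDl ?inner_ge0.
have t0 : 0 < t by rewrite lt_min !divr_gt0//=.
have td : t < d by rewrite gt_min ltr_pdivrMr// mulr_natr mulr2n ltrDl d0.
have te : t * inner h h <= e.
  apply: (@le_trans _ _ (t * (inner h h + 1))).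
    by rewrite (ler_wpM2l (ltW t0))// lerDl.
  by rewrite -ler_pdivlMr// ge_min lexx orbT.
have [fin /ler_normlP[_ H1]] := H t t0 td.
have := puz (u + t *: h).
rewrite -(fineK (ediff_fin du)) -(fineK fin) -!EFinD lee_fin.
rewrite -/g in H1.
rewrite !enorm_sqr !innerE (innerC z) (innerC h u) => H2.
have H3 : 0 <= 2 * eta * (fine (phi (u + t *: h)) - fine (phi u))
   + 2 * t * inner u h + t * (t * inner h h) - 2 * t * inner z h.
  have e2 : 0 < (2 * eta) by rewrite mulr_gt0.
  move: H2; rewrite -(ler_pM2l e2) !mulrDr !mulrA.
  rewrite [2 * eta * 1]mulr1 mulfV ?lt0r_neq0// !mul1r (innerC h z) => H2.
  by lra.
have e2 : 0 < (2 * eta) by rewrite mulr_gt0.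
rewrite -(ler_pM2l e2) in H1.
rewrite -(ler_pM2l t0) in te.
have E : 2 * eta * (t * (e / eta / 2)) = t * e by field; rewrite lt0r_neq0.
rewrite -(ler_pM2l t0).
lra.
Qed.

End Gradient.

(** * Block sparsity and its proximal points *)

Section Sparsity.
Context {R : realType} {k : nat} {T : finType}.
Variable b : 'I_k -> T.
Implicit Types (x y z v w : 'cV[R]_k).

(** The labels [b] cut the coordinates into blocks; the pattern of [x] is the
    set of blocks on which [x] does not vanish. *)
Definition pattern x : {set T} := (b @: [set i | x i 0 != 0])%SET.

Definition sparsity (gamma : R) x : \bar R := (gamma * #|pattern x|%:R)%:E.

Lemma patternP (c : T) x :
  reflect (exists2 i, b i = c & x i 0 != 0) (c \in pattern x).
Proof.
apply: (iffP imsetP); last by case=> i <- xi; exists i; rewrite ?inE.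
by case=> i; rewrite inE => xi ->; exists i.
Qed.

Lemma pattern_comb x y (t : R) :
  (pattern (x + t *: y) \subset pattern x :|: pattern y)%SET.
Proof.
apply/fintype.subsetP => c /patternP[i bic xyi]; rewrite inE.
have [xi|xi] := eqVneq (x i 0) 0; last by apply/orP; left; apply/patternP; exists i.
apply/orP; right; apply/patternP; exists i => //.
by apply: contraNneq xyi => yi; rewrite !mxE xi yi mulr0 addr0.
Qed.

(** This is the lower semicontinuity of the number of nonzero blocks. *)
Lemma pattern_lsc (xs : nat -> 'cV[R]_k) x : xs n @[n --> \oo] --> x ->
  \forall n \near \oo, pattern x \subset pattern (xs n).
Proof.
move=> xsx.
have [e e0 He] : exists2 e, 0 < e & forall i, x i 0 != 0 -> e <= `|x i 0|.
  (* the default value 1 of the minimum serves the vector 0 *)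
  pose e := \big[Num.min/1]_(i | x i 0 != 0) `|x i 0|.
  exists e; last by move=> i xi; exact: bigmin_le_cond.
  by apply: lt_bigmin => // i xi; rewrite normr_gt0.
near=> n.
apply/fintype.subsetP => c /patternP[i bic xi]; apply/patternP; exists i => //.
apply: contraTneq (He i xi) => xni; rewrite -ltNge.
have -> : `|x i 0| = `|(xs n - x) i 0| by rewrite !mxE xni sub0r normrN.
apply: le_lt_trans (coord_le_enorm _ _) _.
near: n; apply: (xsx [set y | enorm (y - x) < e]).
by apply/nbhs_enormP; exists e.
Unshelve. all: by end_near. Qed.

Variables (eta gamma : R).
Hypotheses (eta0 : 0 < eta) (gamma0 : 0 < gamma).

Lemma prox_sparsity_le z v w : prox eta (sparsity gamma) z v ->
  2 * eta * gamma * #|pattern v|%:R + inner (v - z) (v - z) <=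
  2 * eta * gamma * #|pattern w|%:R + inner (w - z) (w - z).
Proof.
move=> /(_ w); rewrite /sparsity -!EFinD lee_fin !enorm_sqr.
have e2 : 0 < 2 * eta by rewrite mulr_gt0.
rewrite -(ler_pM2l e2) !mulrDr !(mulrA (2 * eta)).
by rewrite mulr1 mulfV ?lt0r_neq0// !mul1r.
Qed.

(** Moving [v] inside the coordinate subspace of its own support does not
    increase the sparsity term, so [v] is the orthogonal projection of [z] on
    that subspace. *)
Lemma prox_sparsity_orth z v y : prox eta (sparsity gamma) z v ->
  pattern y \subset pattern v -> inner y (v - z) = 0.
Proof.
move=> pv yv.
have H (t : R) : 0 <= 2 * t * inner y (v - z) + t ^+ 2 * inner y y.
  have := prox_sparsity_le (v + t *: y) pv.
  have le : (#|pattern (v + t *: y)|%:R : R) <= #|pattern v|%:R.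
    rewrite ler_nat; apply: subset_leq_card.
    apply: (fintype.subset_trans (pattern_comb _ _ _)).
    by rewrite finset.subUset yv fintype.subxx.
  have e2 : 0 < 2 * eta * gamma by rewrite !mulr_gt0.
  rewrite -(ler_pM2l e2) in le.
  rewrite [v + _ - z]addrAC (innerDl (v - z)) !(innerDr (v - z)) !innerZl !innerZr (innerC _ y).
  by lra.
set a := inner y (v - z) in H *; set c := inner y y in H.
have c0 : 0 <= c by exact: inner_ge0.
have c1 : 0 < c + 1 by rewrite ltr_wpDl.
(* nearly the minimizer of the quadratic [H]; adding 1 avoids a zero denominator *)
have := H (- (a / (c + 1))).
have -> : 2 * - (a / (c + 1)) * a + (- (a / (c + 1))) ^+ 2 * c =
  - ((c + 2) * (a / (c + 1)) ^+ 2).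
  by field; rewrite lt0r_neq0.
rewrite oppr_ge0 pmulr_rle0 ?ltr_wpDl// => h.
have /eqP : (a / (c + 1)) ^+ 2 = 0 by apply/eqP; rewrite eq_le h sqr_ge0.
by rewrite sqrf_eq0 mulf_eq0 invr_eq0 (gt_eqF c1) orbF => /eqP.
Qed.

Lemma prox_sparsity_dist z v : prox eta (sparsity gamma) z v ->
  inner (v - z) (v - z) <= 2 * eta * gamma * #|T|%:R.
Proof.
move=> /(prox_sparsity_le z); rewrite subrr inner0l.
rewrite addr0; have e2 : 0 < 2 * eta * gamma by rewrite !mulr_gt0.
have : (#|pattern z|%:R : R) <= #|T|%:R by rewrite ler_nat max_card.
rewrite -(ler_pM2l e2) => h1.
have : (0 : R) <= 2 * eta * gamma * #|pattern v|%:R by rewrite mulr_ge0// ltW.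
lra.
Qed.

(** Hard thresholding: deleting a block of [v] saves [gamma], so an active block
    must be worth keeping. *)
Lemma prox_sparsity_gap z v y c : prox eta (sparsity gamma) z v ->
  c \in pattern v -> c \notin pattern y ->
  2 * eta * gamma <= inner (v - y) (v - y).
Proof.
move=> pv cv cy.
pose e : 'cV[R]_k := \col_i (if b i == c then v i 0 else 0).
have ev : pattern e \subset pattern v.
  apply/fintype.subsetP => d /patternP[i bid]; rewrite mxE.
  by case: ifP => _; rewrite ?eqxx// => vi; apply/patternP; exists i.
have oe := prox_sparsity_orth pv ev.
have card : ((#|pattern (v - e)|%:R : R) + 1 <= #|pattern v|%:R).
  rewrite natr1 ler_nat (cardsD1 c (pattern v)) cv ltnS subset_leq_card//.
  apply/fintype.subsetP => d /patternP[i bid]; rewrite !mxE in_setD1 -bid.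
  case: ifP => bic; rewrite ?subrr ?eqxx// subr0 => vi.
  by apply/andP; split; [exact: negbT|apply/patternP; exists i].
have := prox_sparsity_le (v - e) pv.
rewrite [v - e - z]addrAC (innerDl (v - z)) !(innerDr (v - z)) !innerNl !innerNr.
rewrite (innerC _ e) oe => h.
have le : inner e e <= inner (v - y) (v - y).
  apply: ler_sum => i _; rewrite !mxE.
  case: ifP => [/eqP bic|_]; last by rewrite mul0r -expr2 sqr_ge0.
  suff -> : y i 0 = 0 by rewrite subr0.
  by apply: contraNeq cy => yi; apply/patternP; exists i.
have e2 : 0 < 2 * eta * gamma by rewrite !mulr_gt0.
by rewrite -(ler_pM2l e2) in card; lra.
Qed.

End Sparsity.

(** * Real sequences *)

Section RealSequences.
Context {R : realType}.
Implicit Types (x e : nat -> R).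

(** The decrease outweighs [C] as soon as [x n] is large, because then [a n] or
    [r n] is large; below that threshold one step cannot go far. *)
Lemma drift_bounded x a r (A B C beta : R) :
  (forall n, 0 <= x n) -> (forall n, 0 <= a n) -> (forall n, 0 <= r n) ->
  0 < A -> 0 < B ->
  (forall n, x n <= a n + r n + beta) ->
  (forall n, x n.+1 ^+ 2 <= x n ^+ 2 - A * r n ^+ 2 - B * a n + C) ->
  exists M, forall n, x n <= M.
Proof.
move=> x0 a0 r0 A0 B0 xle xS.
pose al := Num.min B (2 * A).
have al0 : 0 < al by rewrite lt_min B0 mulr_gt0.
pose D := C + al * beta + A.
have step n : x n.+1 ^+ 2 <= x n ^+ 2 + D - al * x n.
  apply: (le_trans (xS n)).
  have h1 : al * a n <= B * a n by rewrite ler_wpM2r// ge_min lexx.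
  have h2 : al * r n <= 2 * A * r n by rewrite ler_wpM2r// ge_min lexx orbT.
  have h3 : al * x n <= al * (a n + r n + beta) by rewrite ler_pM2l.
  have h4 : 0 <= A * (r n - 1) ^+ 2 by rewrite mulr_ge0 ?sqr_ge0// ltW.
  by rewrite /D; lra.
pose M2 := Num.max (x 0%N ^+ 2) ((D / al) ^+ 2 + D).
have bnd n : x n ^+ 2 <= M2.
  elim: n => [|n IHn]; first by rewrite le_max lexx.
  have [big|small] := leP (D / al) (x n).
    apply: le_trans IHn; apply: (le_trans (step n)).
    by move: big; rewrite ler_pdivrMr//; lra.
  apply: (le_trans (step n)); rewrite le_max; apply/orP; right.
  have h1 : x n ^+ 2 <= (D / al) ^+ 2 by rewrite ler_sqr ?nnegrE ?(le_trans (x0 n))// ltW.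
  have h2 : 0 <= al * x n by rewrite mulr_ge0// ltW.
  by lra.
exists (Num.sqrt M2) => n.
by rewrite -[x n]ger0_norm// -sqrtr_sqr ler_wsqrtr.
Qed.

Lemma telescope_cvg0 x e (m : R) :
  (forall n, 0 <= e n) -> (forall n, m <= x n) ->
  (forall n, x n.+1 + e n <= x n) -> e n @[n --> \oo] --> (0 : R).
Proof.
move=> e0 mx xS.
have xl : cvgn x.
  apply: nonincreasing_is_cvgn.
    by apply/nonincreasing_seqP => n; have := xS n; have := e0 n; lra.
  by exists m => _ [n _ <-].
have dx : (x n - x n.+1) @[n --> \oo] --> (0 : R).
  rewrite -(subrr (limn x)); apply: cvgB => //.
  by have := xl; rewrite -[X in X -> _]cvg_shiftS.
apply: (@squeeze_cvgr _ _ _ _ (fun=> 0) _ _ _ (0 : R) (cvg_cst _) dx).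
by near=> n; rewrite e0/=; have := xS n; lra.
Unshelve. all: by end_near. Qed.

Lemma cvg_subseq_nat (V : topologicalType) (y : nat -> V) (l : V) (sigma : nat -> nat) :
  (forall n, (n <= sigma n)%N) -> y n @[n --> \oo] --> l ->
  y (sigma n) @[n --> \oo] --> l.
Proof.
move=> ls yl; apply: (cvg_comp sigma y _ yl) => P [N _ NP].
by exists N => // n /= Nn; apply: NP; exact: leq_trans (ls n).
Qed.

Lemma monotone_subseq_cvg0 x K (sigma : nat -> nat) :
  (forall n, 0 <= x n) -> (forall n, (K <= n)%N -> x n.+1 <= x n) ->
  (forall n, (n <= sigma n)%N) -> x (sigma n) @[n --> \oo] --> (0 : R) ->
  x n @[n --> \oo] --> (0 : R).
Proof.
move=> x0 xS ls xs.
have mono i j : (K <= i)%N -> (i <= j)%N -> x j <= x i.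
  move=> Ki; elim: j => [|j IHj]; first by rewrite leqn0 => /eqP <-.
  rewrite leq_eqVlt => /orP[/eqP <- //|]; rewrite ltnS => ij.
  by rewrite (le_trans (xS _ _)) ?IHj// (leq_trans Ki).
apply/cvgrPdist_lt => e e0.
have /cvgrPdist_lt/(_ _ e0)[N _ HN] := xs.
pose n0 := sigma (maxn N K).
have Kn0 : (K <= n0)%N by rewrite (leq_trans _ (ls _)) ?leq_maxr.
near=> n; rewrite sub0r normrN ger0_norm//.
apply: (@le_lt_trans _ _ (x n0)).
  by apply: mono => //; near: n; exact: nbhs_infty_ge.
by have := HN (maxn N K) (leq_maxl _ _); rewrite sub0r normrN ger0_norm.
Unshelve. all: by end_near. Qed.

End RealSequences.

(** * Douglas-Rachford splitting for a convex function plus block sparsity *)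

Section FejerIdentity.
Context {R : realType} {k : nat}.

(** One relaxed Douglas-Rachford step, seen from the point [p + eta c]. When the
    last inner product vanishes and [c] is the gradient at [p], this is Fejer
    monotonicity; the case [c = 0] is used to bound the iterates. *)
Lemma fejer_identity (eta xi : R) (u v g p c : 'cV[R]_k) :
  let s := u + eta *: g in
  let y := p + eta *: c in
  inner (s + xi *: (v - u) - y) (s + xi *: (v - u) - y) =
  inner (s - y) (s - y) - xi * (2 - xi) * inner (v - u) (v - u)
  - 2 * xi * eta * inner (u - p) (g - c)
  + 2 * xi * inner (v - p) (v - u + eta *: g - eta *: c).
Proof.
move=> s y.
pose a := u - p; pose h := g - c; pose r := v - u.
have -> : s + xi *: (v - u) - y = a + eta *: h + xi *: r.
  by apply/colP => i; rewrite !mxE; ring.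
have -> : s - y = a + eta *: h by apply/colP => i; rewrite !mxE; ring.
have -> : v - p = a + r by apply/colP => i; rewrite !mxE; ring.
have -> : v - u + eta *: g - eta *: c = r + eta *: h.
  by apply/colP => i; rewrite !mxE; ring.
rewrite -/a -/h -/r; clearbody a h r.
rewrite !innerE (innerC h a) (innerC r a) (innerC r h).
by ring.
Qed.

End FejerIdentity.

Section DouglasRachford.
Context {R : realType} {k : nat} {T : finType}.
Variable b : 'I_k -> T.
Variables (eta xi L gamma K1 : R) (f : 'cV[R]_k -> R) (G : 'cV[R]_k -> 'cV[R]_k).
Variables (S : set 'cV[R]_k) (u v s : nat -> 'cV[R]_k).
Hypotheses (eta0 : 0 < eta) (xi0 : 0 < xi) (xi2 : xi < 2) (gamma0 : 0 < gamma).
Hypotheses (L0 : 0 < L) (K10 : 0 < K1).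
Hypotheses (etaL : eta * L < 1) (etaxi : 2 * (eta * L) < 2 - xi).
(* [G] stands for the gradient of [f]. Keeping both abstract leaves only the
   inequalities of a smooth convex function between points of [S]. *)
Hypothesis grad_le :
  forall x y, S x -> S y -> f x + inner (G x) (y - x) <= f y.
Hypothesis grad_lip :
  forall x y, S x -> S y -> enorm (G x - G y) <= L * enorm (x - y).
Hypothesis coercive : forall x, S x -> enorm x <= K1 * f x.
Hypothesis closedS : closed S.
Hypothesis uS : forall n, S (u n).
Hypothesis DR_s : forall n, s n = u n + eta *: G (u n).
Hypothesis DR_z :
  forall n, prox eta (sparsity b gamma) (u n - eta *: G (u n)) (v n).
Hypothesis DR_step : forall n, s n.+1 = s n + xi *: (v n - u n).

Local Notation g n := (G (u n)).
Local Notation r n := (v n - u n).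
Local Notation z n := (u n - eta *: g n).
Local Notation card_pattern x := (#|pattern b x|%:R : R).

Lemma grad_mono x y : S x -> S y -> 0 <= inner (x - y) (G x - G y).
Proof.
move=> Sx Sy; have := grad_le Sx Sy; have := grad_le Sy Sx.
rewrite !innerE (innerC x (G x)) (innerC x (G y)) (innerC y (G x)) (innerC y (G y)).
lra.
Qed.

Lemma DR_vz n : v n - z n = r n + eta *: g n.
Proof. by apply/colP => i; rewrite !mxE; ring. Qed.

Lemma DR_self_orth n : inner (v n) (r n + eta *: g n) = 0.
Proof.
by rewrite -DR_vz; apply: (prox_sparsity_orth eta0 gamma0 (DR_z n)).
Qed.

(** ** Boundedness *)

Let b1 := Num.sqrt (2 * eta * gamma * #|T|%:R).

Lemma DR_vz_le n : enorm (r n + eta *: g n) <= b1.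
Proof.
rewrite -DR_vz; apply: enorm_le; first exact: sqrtr_ge0.
rewrite sqr_sqrtr ?mulr_ge0 ?(ltW eta0) ?(ltW gamma0)//.
exact: (prox_sparsity_dist eta0 gamma0 (DR_z n)).
Qed.

(** [s n] follows relaxed gradient descent on the Moreau envelope of [f],
    perturbed by the bounded vectors [r n + eta g n], each orthogonal to [v n];
    that orthogonality is what keeps the perturbation from being multiplied by
    the size of the iterates. *)
Lemma DR_bounded_s : exists M, forall n, enorm (s n - u 0%N) <= M.
Proof.
apply: (@drift_bounded _ _ (fun n => enorm (u n)) (fun n => enorm (r n))
  (xi * (2 - xi)) (2 * xi * eta / K1)
  (2 * xi * (eta * f (u 0%N) + enorm (u 0%N) * b1)) (b1 + enorm (u 0%N))).
- by move=> n; exact: enorm_ge0.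
- by move=> n; exact: enorm_ge0.
- by move=> n; exact: enorm_ge0.
- by rewrite mulr_gt0// subr_gt0.
- by rewrite divr_gt0// !mulr_gt0.
- move=> n; have -> : s n - u 0%N = u n - r n + (r n + eta *: g n) - u 0%N.
    by rewrite DR_s; apply/colP => i; rewrite !mxE; ring.
  have h1 := enormB (u n - r n + (r n + eta *: g n)) (u 0%N).
  have h2 := enormD (u n - r n) (r n + eta *: g n).
  have h3 := enormB (u n) (r n).
  by have h4 := DR_vz_le n; lra.
move=> n; rewrite !enorm_sqr DR_step DR_s.
have := fejer_identity eta xi (u n) (v n) (g n) (u 0%N) 0.
rewrite /= scaler0 addr0 !subr0 => ->.
have h1 : inner (v n - u 0%N) (r n + eta *: g n) <= enorm (u 0%N) * b1.
  rewrite innerDl DR_self_orth add0r innerNl.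
  apply: (le_trans (ler_norm _)); rewrite normrN.
  apply: (le_trans (abs_inner_le _ _)).
  by rewrite ler_wpM2l ?enorm_ge0// DR_vz_le.
have h2 : enorm (u n) / K1 - f (u 0%N) <= inner (u n - u 0%N) (g n).
  have := grad_le (uS n) (uS 0%N).
  have : enorm (u n) / K1 <= f (u n) by rewrite ler_pdivrMr// mulrC coercive.
  by rewrite !innerE (innerC (u n)) (innerC (u 0%N)); lra.
have x2 : 0 < 2 * xi by rewrite mulr_gt0.
have x2e : 0 < 2 * xi * eta by rewrite mulr_gt0.
rewrite -(ler_pM2l x2) in h1; rewrite -(ler_pM2l x2e) in h2.
by lra.
Qed.

(** Firm nonexpansiveness of the first proximal map, from monotonicity of [G]. *)
Lemma DR_nonexpansive x n : S x ->
  inner (u n - x) (u n - x) <= inner (s n - (x + eta *: G x)) (s n - (x + eta *: G x)).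
Proof.
move=> Sx; rewrite DR_s.
have -> : u n + eta *: g n - (x + eta *: G x) = u n - x + eta *: (g n - G x).
  by apply/colP => i; rewrite !mxE; ring.
have := grad_mono (uS n) Sx.
set a := u n - x; set h := g n - G x => ah; clearbody a h.
rewrite !innerE (innerC h a).
have h1 : 0 <= eta * (eta * inner h h) by rewrite !mulr_ge0 ?inner_ge0 ?ltW.
have h2 : 0 <= eta * inner a h by rewrite mulr_ge0// ltW.
lra.
Qed.

Lemma DR_bounded : exists M, forall n,
  enorm (u n) <= M /\ enorm (eta *: g n) <= M.
Proof.
have [M HM] := DR_bounded_s.
exists (3 * M + enorm (u 0%N)) => n.
have un : enorm (u n - u 0%N) <= 2 * M.
  have M0 : 0 <= M by rewrite (le_trans _ (HM 0%N))// enorm_ge0.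
  have s2 : enorm (s n - s 0%N) <= 2 * M.
    have -> : s n - s 0%N = (s n - u 0%N) - (s 0%N - u 0%N).
      by apply/colP => i; rewrite !mxE; ring.
    apply: (le_trans (enormB _ _)).
    by have := HM n; have := HM 0%N; lra.
  apply: le_trans s2; apply: enorm_le; first exact: enorm_ge0.
  by rewrite enorm_sqr [s 0%N]DR_s; exact: DR_nonexpansive.
have M0 := le_trans (enorm_ge0 _) (HM 0%N).
split.
  have -> : u n = (u n - u 0%N) + u 0%N by rewrite subrK.
  by have := enormD (u n - u 0%N) (u 0%N); lra.
have -> : eta *: g n = (s n - u 0%N) - (u n - u 0%N).
  by rewrite DR_s; apply/colP => i; rewrite !mxE; ring.
have := enormB (s n - u 0%N) (u n - u 0%N).
by have := HM n; have := enorm_ge0 (u 0%N); lra.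
Qed.

(** ** Sufficient decrease *)

(** The Douglas-Rachford envelope: the value reached when [f] is replaced by its
    quadratic model around [u n], with curvature [1 / eta], and the sum of this
    model and the sparsity term is minimized, which is what the second proximal
    step does. *)
Definition merit n : R :=
  f (u n) + gamma * card_pattern (v n) + inner (g n) (r n)
  + inner (r n) (r n) / (2 * eta).

(** Completing the square leaves [- |eta G|^2 / (2 eta)], bounded by [DR_bounded];
    the values [f (v n)] are unavailable because [v n] may leave [S]. *)
Lemma merit_lower : exists m, forall n, m <= merit n.
Proof.
have [M HM] := DR_bounded.
exists (- (M ^+ 2 / (2 * eta))) => n; have [_ gM] := HM n.
have f0 : 0 <= f (u n).
  by rewrite -(pmulr_rge0 _ K10) (le_trans _ (coercive (uS n)))// enorm_ge0.
have c0 : 0 <= gamma * card_pattern (v n) by rewrite mulr_ge0// ltW.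
have e2 : 0 < 2 * eta by rewrite mulr_gt0.
have g2 : inner (eta *: g n) (eta *: g n) <= M ^+ 2.
  rewrite -enorm_sqr ler_sqr ?nnegrE ?enorm_ge0//.
  exact: le_trans (enorm_ge0 _) gM.
have := inner_ge0 (r n + eta *: g n).
rewrite innerDl !(innerDr (r n)) => h.
rewrite /merit -(ler_pM2l e2) !mulrDr mulrN !(mulrCA (2 * eta)) mulfV ?lt0r_neq0//.
have : 0 <= 2 * eta * f (u n) by rewrite mulr_ge0// ltW.
have : 0 <= 2 * eta * (gamma * card_pattern (v n)) by rewrite mulr_ge0// ltW.
move: h; rewrite (innerZl eta (g n) (r n)) (innerC (r n)) innerZl.
by lra.
Qed.

Lemma DR_increment n : xi *: r n = (u n.+1 - u n) + eta *: (g n.+1 - g n).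
Proof.
have := DR_step n; rewrite !DR_s => /(congr1 (fun x => x - (u n + eta *: g n))).
by move=> h; apply/colP => i; move/colP/(_ i): h; rewrite !mxE; lra.
Qed.

(** The new minimum is compared with the new model taken at the old [v n].
    Writing [d] and [h] for the increments of [u] and of the gradient, the
    relation [xi r = d + eta h] turns the gain into
    [((2 - xi) / 2 |d|^2 - eta^2 |h|^2) / (xi eta)], and [|h| <= L |d|]. *)
Lemma merit_decrease : exists2 c, 0 < c & forall n,
  merit n.+1 + c * inner (u n.+1 - u n) (u n.+1 - u n) <= merit n.
Proof.
exists (((2 - xi) / 2 - (eta * L) ^+ 2) / (xi * eta)).
  rewrite divr_gt0 ?mulr_gt0// subr_gt0.
  have : eta * L * (eta * L) < eta * L * 1 by rewrite ltr_pM2l// mulr_gt0.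
  by move: etaxi; rewrite expr2; lra.
move=> n.
have [e2 x0 e0] : [/\ 0 < 2 * eta, xi != 0 & eta != 0].
  by split; [rewrite mulr_gt0|rewrite lt0r_neq0|rewrite lt0r_neq0].
have := prox_sparsity_le eta0 (v n) (DR_z n.+1).
have := grad_le (uS n.+1) (uS n).
have := grad_lip (uS n.+1) (uS n).
rewrite DR_vz /merit.
pose d := u n.+1 - u n; pose h := g n.+1 - g n.
have rE : r n = xi^-1 *: (d + eta *: h).
  by rewrite -DR_increment scalerA mulVf// scale1r.
have -> : v n - z n.+1 = r n - d + eta *: g n.+1.
  by rewrite /d; apply/colP => i; rewrite !mxE; ring.
have -> : u n - u n.+1 = - d by rewrite opprB.
rewrite -/h -/d.
have -> : g n = g n.+1 - h by rewrite /h opprB addrC subrK.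
rewrite -/h -/d in rE *.
move: rE; set rn := r n; set rn1 := r n.+1; set g1 := g n.+1.
move=> rE hd fd pd; clearbody rn rn1 g1 d h.
have hh : inner h h <= L ^+ 2 * inner d d.
  rewrite -!enorm_sqr -exprMn ler_sqr ?nnegrE ?enorm_ge0// mulr_ge0 ?enorm_ge0 ?ltW//.
move: pd; rewrite !(innerDl _ (eta *: g1)) !(innerDr _ (eta *: g1)) !innerZl !innerZr.
rewrite (innerC rn1 g1) (innerC (rn - d) g1).
rewrite !innerDl !innerDr !innerNl !innerNr (innerC d rn).
move: fd; rewrite innerNr => fd pd.
have {}pd : gamma * card_pattern (v n.+1) + inner rn1 rn1 / (2 * eta) + inner g1 rn1
  <= gamma * card_pattern (v n) + (inner rn rn - 2 * inner rn d + inner d d) / (2 * eta)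
     + inner g1 rn - inner g1 d.
  rewrite -(ler_pM2l e2) !mulrDr mulrN !(mulrCA (2 * eta) _ (_^-1)) mulfV ?lt0r_neq0//.
  by rewrite !mulr1; lra.
suff key : ((2 - xi) / 2 - (eta * L) ^+ 2) / (xi * eta) * inner d d
    <= - inner h rn + (2 * inner rn d - inner d d) / (2 * eta).
  have E : (inner rn rn - 2 * inner rn d + inner d d) / (2 * eta) =
    inner rn rn / (2 * eta) - (2 * inner rn d - inner d d) / (2 * eta) by ring.
  by rewrite E in pd; lra.
rewrite rE !innerZl !innerZr !innerDl !innerDr !innerZl !innerZr (innerC h d).
have -> : - (xi^-1 * (inner d h + eta * inner h h)) +
  (2 * (xi^-1 * (inner d d + eta * inner d h)) - inner d d) / (2 * eta) =
  ((2 - xi) / 2 * inner d d - eta ^+ 2 * inner h h) / (xi * eta).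
  by field; rewrite x0 e0.
rewrite mulrAC ler_pM2r ?invr_gt0 ?mulr_gt0// mulrBl lerD2l lerN2.
by rewrite exprMn -[leRHS]mulrA ler_pM2l ?exprn_gt0.
Qed.

Lemma increments_cvg0 : enorm (u n.+1 - u n) @[n --> \oo] --> (0 : R).
Proof.
have [m mle] := merit_lower; have [c c0 dec] := merit_decrease.
have h : c * inner (u n.+1 - u n) (u n.+1 - u n) @[n --> \oo] --> (0 : R).
  apply: (telescope_cvg0 _ mle) dec => n.
  by rewrite mulr_ge0 ?inner_ge0// ltW.
have -> : (fun n => enorm (u n.+1 - u n)) =
    (fun n => Num.sqrt (c^-1 * (c * inner (u n.+1 - u n) (u n.+1 - u n)))).
  by apply/funext => n; rewrite mulKf ?lt0r_neq0.
rewrite -(@sqrtr0 R) -(mulr0 c^-1).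
apply: continuous_cvg; first exact: sqrt_continuous.
by apply: cvgM h; exact: cvg_cst.
Qed.

Lemma residual_cvg0 : enorm (r n) @[n --> \oo] --> (0 : R).
Proof.
pose c := (1 + eta * L) / xi.
have h : c * enorm (u n.+1 - u n) @[n --> \oo] --> (0 : R).
  rewrite -(mulr0 c); apply: cvgM increments_cvg0; exact: cvg_cst.
apply: (@squeeze_cvgr _ _ _ _ (fun=> 0) _ _ _ (0 : R) (cvg_cst _) h).
near=> n; rewrite enorm_ge0/= /c mulrAC ler_pdivlMr// mulrC.
rewrite -{1}(gtr0_norm xi0) -enormZ DR_increment.
apply: (le_trans (enormD _ _)); rewrite mulrDl mul1r lerD2l enormZ gtr0_norm//.
rewrite -mulrA ler_pM2l//; exact: grad_lip.
Unshelve. all: by end_near. Qed.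

(** ** Identification of the pattern *)

(** Consecutive [v n] get arbitrarily close, whereas changing the
    pattern costs a jump of at least [sqrt (2 eta gamma)]. *)
Lemma pattern_stationary :
  exists K, forall n, (K <= n)%N -> pattern b (v n) = pattern b (v K).
Proof.
have h : enorm (u n.+1 - u n) + enorm (r n.+1) + enorm (r n) @[n --> \oo] --> (0 : R).
  rewrite -[X in _ --> X](addr0 (0 : R)) -{1}(addr0 (0 : R)).
  apply: cvgD residual_cvg0; apply: cvgD increments_cvg0 _.
  by have := residual_cvg0; rewrite -[X in X -> _]cvg_shiftS.
have e2 : 0 < 2 * eta * gamma by rewrite !mulr_gt0.
have s0 : 0 < Num.sqrt (2 * eta * gamma) by rewrite sqrtr_gt0.
have /cvgrPdist_lt/(_ _ s0)[K _ HK] := h.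
have step n : (K <= n)%N -> pattern b (v n.+1) = pattern b (v n).
  move=> Kn; have := HK n Kn; rewrite sub0r normrN ger0_norm; last first.
    by rewrite !addr_ge0 ?enorm_ge0.
  move=> close.
  have {}close : inner (v n.+1 - v n) (v n.+1 - v n) < 2 * eta * gamma.
    rewrite -enorm_sqr -[ltRHS]sqr_sqrtr ?ltW// ltr_sqr ?nnegrE ?enorm_ge0 ?sqrtr_ge0//.
    apply: le_lt_trans close.
    have -> : v n.+1 - v n = (u n.+1 - u n) + r n.+1 - r n.
      by apply/colP => i; rewrite !mxE; ring.
    by apply: (le_trans (enormB _ _)); rewrite lerD2r enormD.
  apply/eqP; rewrite finset.eqEsubset; apply/andP; split; apply/fintype.subsetP => c cv.
    apply/negPn/negP => cn.
    by have := prox_sparsity_gap eta0 gamma0 (DR_z n.+1) cv cn; rewrite leNgt close.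
  apply/negPn/negP => cn.
  have := prox_sparsity_gap eta0 gamma0 (DR_z n) cv cn.
  by rewrite -opprB innerNl innerNr opprK leNgt close.
exists K => n; elim: n => [|n IHn]; first by rewrite leqn0 => /eqP <-.
by rewrite leq_eqVlt => /orP[/eqP <- //|]; rewrite ltnS => Kn; rewrite step// IHn.
Qed.

(** ** Convergence *)

Lemma DR_cluster : exists u' (sigma : nat -> nat),
  [/\ S u', forall n, (n <= sigma n)%N,
      u (sigma n) @[n --> \oo] --> u',
      v (sigma n) @[n --> \oo] --> u' &
      r (sigma n) + eta *: g (sigma n) @[n --> \oo] --> eta *: G u'].
Proof.
have [M HM] := DR_bounded.
have [u' [sigma [ls us]]] := bolzano_weierstrass (fun n => (HM n).1).
have rs := cvg_subseq_nat ls residual_cvg0.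
have du : enorm (u (sigma n) - u') @[n --> \oo] --> (0 : R) by apply/cvg_enorm.
have Su' : S u'.
  by apply: (closed_cvg _ closedS _ _ us) => //; near=> n; exact: uS.
exists u', sigma; split => //.
- apply/cvg_enorm.
  have h : enorm (r (sigma n)) + enorm (u (sigma n) - u') @[n --> \oo] --> (0 : R).
    by rewrite -(addr0 (0 : R)); exact: cvgD.
  apply: (@squeeze_cvgr _ _ _ _ (fun=> 0) _ _ _ (0 : R) (cvg_cst _) h).
  near=> n; rewrite enorm_ge0/=.
  have -> : v (sigma n) - u' = r (sigma n) + (u (sigma n) - u').
    by apply/colP => i; rewrite !mxE; ring.
  exact: enormD.
apply/cvg_enorm.
have h : enorm (r (sigma n)) + eta * L * enorm (u (sigma n) - u') @[n --> \oo] --> (0 : R).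
  rewrite -(addr0 (0 : R)); apply: cvgD => //.
  rewrite -(mulr0 (eta * L)); apply: cvgM => //; exact: cvg_cst.
apply: (@squeeze_cvgr _ _ _ _ (fun=> 0) _ _ _ (0 : R) (cvg_cst _) h).
near=> n; rewrite enorm_ge0/= -addrA -scalerBr.
apply: (le_trans (enormD _ _)); rewrite lerD2l enormZ gtr0_norm// -mulrA ler_pM2l//.
exact: grad_lip.
Unshelve. all: by end_near. Qed.

(** Once the pattern is fixed, every [v i] is orthogonal to every residual
    [w j]: the second proximal map acts as a projection on one fixed subspace,
    and the iteration is the one for a convex function on that subspace. It is
    Fejer monotone with respect to the cluster point, hence converges to it. *)
Lemma DR_limit : exists u',
  [/\ S u', u n @[n --> \oo] --> u' & v n @[n --> \oo] --> u'].
Proof.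
have [u' [sigma [Su' ls us vs bs]]] := DR_cluster.
have [K HK] := pattern_stationary.
pose w n := r n + eta *: g n.
have orth i j : (K <= i)%N -> (K <= j)%N -> inner (v i) (w j) = 0.
  move=> Ki Kj; rewrite /w -DR_vz; apply: (prox_sparsity_orth eta0 gamma0 (DR_z j)).
  by rewrite !HK.
have lim0 (x : nat -> R) l : (forall n, (K <= n)%N -> x n = 0) ->
    x n @[n --> \oo] --> l -> l = 0.
  move=> x0 xl; apply: (cvg_unique _ xl) => //=.
  apply: cvg_near_cst; near=> n; apply: x0; near: n; exact: nbhs_infty_ge.
have Ks n : (K <= n)%N -> (K <= sigma n)%N by move=> Kn; exact: leq_trans (ls n).
have orth_vg i : (K <= i)%N -> inner (v i) (eta *: G u') = 0.
  move=> Ki; apply: (lim0 (fun n => inner (v i) (w (sigma n)))).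
    by move=> n Kn; rewrite orth// Ks.
  by apply: cvg_inner => //; exact: cvg_cst.
have orth_uw i : (K <= i)%N -> inner u' (w i) = 0.
  move=> Ki; apply: (lim0 (fun n => inner (v (sigma n)) (w i))).
    by move=> n Kn; rewrite orth// Ks.
  by apply: cvg_inner => //; exact: cvg_cst.
have orth_ug : inner u' (eta *: G u') = 0.
  apply: (lim0 (fun n => inner (v (sigma n)) (eta *: G u'))).
    by move=> n Kn; rewrite orth_vg// Ks.
  by apply: cvg_inner => //; exact: cvg_cst.
pose s' := u' + eta *: G u'.
pose q n := inner (s n - s') (s n - s').
have q0 n : 0 <= q n by exact: inner_ge0.
have qS n : (K <= n)%N -> q n.+1 <= q n.
  move=> Kn; rewrite /q DR_step DR_s fejer_identity.
  have -> : inner (v n - u') (r n + eta *: g n - eta *: G u') = 0.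
    rewrite -/(w n) innerDl innerNl !(innerDr (w n)) !innerNr.
    by rewrite orth// orth_vg// orth_uw// orth_ug !subr0.
  have h1 : 0 <= xi * (2 - xi) * inner (r n) (r n).
    by rewrite mulr_ge0 ?inner_ge0// mulr_ge0 ?subr_ge0 ?ltW.
  have h2 : 0 <= 2 * xi * eta * inner (u n - u') (g n - G u').
    by rewrite mulr_ge0 ?grad_mono// ltW// !mulr_gt0.
  by lra.
have qs : q (sigma n) @[n --> \oo] --> (0 : R).
  have ss : s (sigma n) - s' @[n --> \oo] --> (0 : 'cV[R]_k).
    have -> : (fun n => s (sigma n) - s') =
        (fun n => u (sigma n) - (v (sigma n) - u (sigma n)) + w (sigma n) - s').
      by apply/funext => n; rewrite DR_s /w; apply/colP => i; rewrite !mxE; ring.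
    rewrite -(subrr s'); apply: cvgB; last exact: cvg_cst.
    apply: cvgD => //; rewrite -[X in _ --> X](subr0 u') -(subrr u').
    by apply: cvgB => //; exact: cvgB.
  by rewrite -(inner0l (0 : 'cV[R]_k)); exact: cvg_inner.
have qc := monotone_subseq_cvg0 q0 qS ls qs.
have sq : Num.sqrt (q n) @[n --> \oo] --> (0 : R).
  rewrite -(@sqrtr0 R); apply: continuous_cvg qc; exact: sqrt_continuous.
have uu : enorm (u n - u') @[n --> \oo] --> (0 : R).
  apply: (@squeeze_cvgr _ _ _ _ (fun=> 0) _ _ _ (0 : R) (cvg_cst _) sq).
  near=> n; rewrite enorm_ge0/= ler_wsqrtr//; exact: DR_nonexpansive.
exists u'; split => //; first exact/cvg_enorm.
apply/cvg_enorm.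
have h : enorm (r n) + enorm (u n - u') @[n --> \oo] --> (0 : R).
  by rewrite -(addr0 (0 : R)); apply: cvgD => //; exact: residual_cvg0.
apply: (@squeeze_cvgr _ _ _ _ (fun=> 0) _ _ _ (0 : R) (cvg_cst _) h).
near=> n; rewrite enorm_ge0/=.
have -> : v n - u' = r n + (u n - u') by apply/colP => i; rewrite !mxE; ring.
exact: enormD.
Unshelve. all: by end_near. Qed.

(** ** Stationarity of the limit *)

(** The limit of the inequalities that express the second proximal step; the
    pattern may only shrink in the limit, which is the right direction. *)
Lemma DR_limit_sparsity u' : S u' -> u n @[n --> \oo] --> u' ->
  v n @[n --> \oo] --> u' -> forall w,
  gamma * card_pattern u' <=
  gamma * card_pattern w + inner (G u') (w - u') + inner (w - u') (w - u') / (2 * eta).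
Proof.
move=> Su' uu vu w.
have gg : g n @[n --> \oo] --> G u'.
  apply/cvg_enorm.
  have h : L * enorm (u n - u') @[n --> \oo] --> (0 : R).
    rewrite -(mulr0 L); apply: cvgM; first exact: cvg_cst.
    exact/cvg_enorm.
  apply: (@squeeze_cvgr _ _ _ _ (fun=> 0) _ _ _ (0 : R) (cvg_cst _) h).
  near=> n; rewrite enorm_ge0/=; exact: grad_lip.
have zz : z n @[n --> \oo] --> u' - eta *: G u'.
  by apply: cvgB => //; apply: cvgZ => //; exact: cvg_cst.
have e2 : 0 < 2 * eta by rewrite mulr_gt0.
have : 2 * eta * gamma * card_pattern u'
    + inner (u' - (u' - eta *: G u')) (u' - (u' - eta *: G u'))
  <= 2 * eta * gamma * card_pattern w
    + inner (w - (u' - eta *: G u')) (w - (u' - eta *: G u')).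
  have vz : inner (v n - z n) (v n - z n) @[n --> \oo] -->
      inner (u' - (u' - eta *: G u')) (u' - (u' - eta *: G u')).
    by apply: cvg_inner; exact: cvgB.
  have wz : inner (w - z n) (w - z n) @[n --> \oo] -->
      inner (w - (u' - eta *: G u')) (w - (u' - eta *: G u')).
    by apply: cvg_inner; apply: cvgB => //; exact: cvg_cst.
  have const c : (fun _ : nat => c) n @[n --> \oo] --> (c : R) by exact: cvg_cst.
  apply: (ler_cvg_to (cvgD (const _) vz) (cvgD (const _) wz)).
  near=> n; apply: (le_trans _ (prox_sparsity_le eta0 w (DR_z n))).
  rewrite lerD2r ler_pM2l ?mulr_gt0// ler_nat subset_leq_card//.
  by near: n; exact: pattern_lsc.
have -> : u' - (u' - eta *: G u') = eta *: G u' by rewrite opprB addrC subrK.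
have -> : w - (u' - eta *: G u') = (w - u') + eta *: G u' by rewrite opprB addrA addrAC.
rewrite innerDl !(innerDr (w - u')) (innerC (w - u') (eta *: _)) (innerZl eta _ (w - u')).
move=> h.
rewrite -(ler_pM2l e2) !mulrDr (mulrCA _ _ (_^-1)) mulfV ?lt0r_neq0// mulr1.
by lra.
Unshelve. all: by end_near. Qed.

End DouglasRachford.

Section DouglasRachfordConvergence.
Context {R : realType} {k : nat} {T : finType}.

(** The limit minimizes [phi1 + sparsity] up to a quadratic, so [0] is even
    a proximal subgradient there. *)
Lemma DR_sparsity_cvg (b : 'I_k -> T) (eta xi L gamma K1 : R)
    (phi1 : 'cV[R]_k -> \bar R) (S : set 'cV[R]_k) (u v s : nat -> 'cV[R]_k) :
  0 < eta -> 0 < xi -> xi < 2 -> 0 < gamma -> 0 < L -> 0 < K1 ->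
  eta * L < 1 -> 2 * (eta * L) < 2 - xi ->
  convex_epi phi1 ->
  (forall x a, (phi1 x <= a%:E)%E -> enorm x <= K1 * a) ->
  closed S -> (forall n, S (u n)) -> Lsmooth_on L phi1 S ->
  DR_iterates eta xi phi1 (sparsity b gamma) u v s ->
  exists u', [/\ u n @[n --> \oo] --> u', v n @[n --> \oo] --> u' &
    lim_subdiff (fun x => phi1 x + sparsity b gamma x)%E u' 0].
Proof.
move=> eta0 xi0 xi2 gamma0 L0 K10 etaL etaxi cphi coer clS uS [diffS lipS] DR.
have finS x : S x -> phi1 x = (fine (phi1 x))%:E.
  by move=> Sx; rewrite fineK// ediff_fin//; exact: diffS.
have leS x y : S x -> S y ->
    fine (phi1 x) + inner (grad phi1 x) (y - x) <= fine (phi1 y).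
  move=> Sx Sy; apply: convex_grad_le => //; first exact: diffS.
  by rewrite -finS.
have coerS x : S x -> enorm x <= K1 * fine (phi1 x).
  by move=> Sx; apply: coer; rewrite -finS.
have sE n : s n = u n + eta *: grad phi1 (u n).
  by have [pu _ _] := DR n; apply: prox_grad => //; exact: diffS.
have vP n : prox eta (sparsity b gamma) (u n - eta *: grad phi1 (u n)) (v n).
  have [_ + _] := DR n; rewrite sE.
  have -> // : 2 *: u n - (u n + eta *: grad phi1 (u n)) = u n - eta *: grad phi1 (u n).
  by rewrite scaler_nat mulr2n opprD addrA addrK.
have step n : s n.+1 = s n + xi *: (v n - u n) by have [] := DR n.
have [u' [Su' uu vu]] :=
  DR_limit eta0 xi0 xi2 gamma0 L0 K10 etaL etaxi leS lipS coerS clS uS sE vP step.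
have lim := DR_limit_sparsity eta0 gamma0 lipS uS vP Su' uu vu.
exists u'; split=> //; set zeta := (fun _ => _).
have fin : zeta u' \is a fin_num by rewrite /zeta (finS _ Su').
split=> //; exists (fun=> u'), (fun=> 0); split; try exact: cvg_cst.
move=> _; split=> // e e0.
have e2 : 0 < 2 * eta by rewrite mulr_gt0.
apply/nbhs_enormP; exists (2 * eta * e); first by rewrite mulr_gt0.
move=> y ye; rewrite /zeta (finS _ Su').
case E : (phi1 y) => [c| |]; last 2 first.
- by rewrite leey.
- have := coer y (- 1); rewrite E leNye => /(_ isT).
  by rewrite mulrN1 => /(le_trans (enorm_ge0 _)); rewrite oppr_ge0 leNgt K10.
rewrite /sparsity -!EFinD lee_fin.
have h1 : fine (phi1 u') + inner (grad phi1 u') (y - u') <= c.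
  by apply: convex_grad_le => //; [exact: diffS|rewrite E].
have h2 := lim y.
have h3 : inner (y - u') (y - u') / (2 * eta) <= e * enorm (y - u').
  rewrite ler_pdivrMr// -enorm_sqr expr2 [leRHS]mulrAC ler_wpM2r ?enorm_ge0//.
  by rewrite mulrC ltW.
rewrite inner0l.
move: h1 h2 h3; move: (grad phi1 u') => G'.
by lra.
Qed.

End DouglasRachfordConvergence.

(** * Vectorized positive semidefinite matrices *)

Section Semidefinite.
Context {R : realType}.

Lemma inner_mulmxr m n (A : 'M[R]_(m, n)) x y :
  inner x (A *m y) = inner (A^T *m x) y.
Proof.
have E k (a b : 'cV[R]_k) : inner a b = (a^T *m b) 0 0.
  by rewrite mxE; apply: eq_bigr => i _; rewrite mxE.
by rewrite !E trmx_mul trmxK mulmxA.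
Qed.

Lemma possemidef_congr k r (T : 'M[R]_(r, k)) (W : 'M[R]_k) :
  possemidef W -> possemidef (T *m W *m T^T).
Proof.
move=> [sW W0]; split; first by rewrite !trmx_mul trmxK sW mulmxA.
by move=> x; rewrite -!mulmxA inner_mulmxr; exact: W0.
Qed.

Lemma possemidef_convex k (X Y : 'M[R]_k) t : 0 <= t <= 1 ->
  possemidef X -> possemidef Y -> possemidef ((1 - t) *: X + t *: Y).
Proof.
move=> /andP[t0 t1] [sX X0] [sY Y0]; split.
  by rewrite linearD/= !linearZ/= sX sY.
move=> x; rewrite mulmxDl -!scalemxAl innerDr !innerZr.
by rewrite addr_ge0// mulr_ge0 ?subr_ge0.
Qed.

Lemma vecD m n (X Y : 'M[R]_(m, n)) : vec (X + Y) = vec X + vec Y.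
Proof. by apply/colP => i; rewrite !mxE. Qed.

Lemma vecZ m n (a : R) (X : 'M[R]_(m, n)) : vec (a *: X) = a *: vec X.
Proof. by apply/colP => i; rewrite !mxE. Qed.

Lemma unvecD m n (x y : 'cV[R]_(n * m)) : unvec (x + y) = unvec x + unvec y.
Proof. by apply/matrixP => i j; rewrite !mxE. Qed.

Lemma unvecZ m n (a : R) (x : 'cV[R]_(n * m)) : unvec (a *: x) = a *: unvec x.
Proof. by apply/matrixP => i j; rewrite !mxE. Qed.

Lemma Gamma_plus_convex k (x y : 'cV[R]_(k * k)) t : 0 <= t <= 1 ->
  Gamma_plus k x -> Gamma_plus k y -> Gamma_plus k ((1 - t) *: x + t *: y).
Proof.
move=> t01 [X X0 <-] [Y Y0 <-]; exists ((1 - t) *: X + t *: Y).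
  exact: possemidef_convex.
by rewrite vecD !vecZ.
Qed.

Lemma inner_vec m n (X Y : 'M[R]_(m, n)) : inner (vec X) (vec Y) = \tr (X^T *m Y).
Proof.
rewrite /inner (reindex (@mxtens_index n m)) /=; last first.
  by exists (@mxtens_unindex n m) => l _; rewrite (mxtens_indexK, mxtens_unindexK).
transitivity (\sum_p (fun j i => X i j * Y i j) p.1 p.2).
  by apply: eq_bigr => -[j i] _; rewrite !mxE mxtens_indexK.
rewrite -(pair_bigA _ (fun j i => X i j * Y i j)) /=.
by apply: eq_bigr => j _; rewrite mxE; apply: eq_bigr => i _; rewrite mxE.
Qed.

Lemma inner_delta k (Y : 'M[R]_k) i j :
  inner (delta_mx i 0) (Y *m delta_mx j 0) = Y i j.
Proof.
rewrite -colE /inner (bigD1 i)//= !mxE !eqxx mul1r big1 ?addr0// => l li.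
by rewrite !mxE (negbTE li) mul0r.
Qed.

(** Test [Y] on the sum and the difference of two basis vectors. *)
Lemma possemidef_entry k (Y : 'M[R]_k) i j : possemidef Y -> `|Y i j| <= \tr Y.
Proof.
move=> [sY Y0].
have diag l : 0 <= Y l l by rewrite -inner_delta.
have trge l : Y l l <= \tr Y.
  by rewrite /mxtrace (bigD1 l)//= lerDl sumr_ge0.
have Yji : Y j i = Y i j by rewrite -[in LHS]sY mxE.
have := Y0 (delta_mx i 0 + delta_mx j 0).
have := Y0 (delta_mx i 0 - delta_mx j 0).
rewrite !mulmxDr mulmxN !innerE !inner_delta Yji => hm hp.
have := trge i; have := trge j.
by rewrite ler_norml => *; apply/andP; split; lra.
Qed.

(** [\tr (T W T^T)] controls [W]: recover [W] from [T W T^T] by a left inverse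
    of [T], and bound the entries of [T W T^T] by its trace. *)
Lemma trace_coercive k r (T : 'M[R]_(r, k)) (T' : 'M[R]_(k, r)) :
  T' *m T = 1%:M ->
  exists2 c : R, 0 <= c & forall W : 'M[R]_k, possemidef W -> forall i j,
    `|W i j| <= c * inner (vec (T^T *m T)) (vec W).
Proof.
move=> T'T; pose c := \sum_i \sum_a `|T' i a|.
have cle i : \sum_a `|T' i a| <= c.
  by rewrite /c (bigD1 i)//= lerDl; apply: sumr_ge0 => l _; apply: sumr_ge0.
have c0 : 0 <= c by apply: sumr_ge0 => i _; apply: sumr_ge0.
exists (c * c); first exact: mulr_ge0.
move=> W psdW i j; have psdY := possemidef_congr T psdW.
have -> : inner (vec (T^T *m T)) (vec W) = \tr (T *m W *m T^T).
  by rewrite inner_vec trmx_mul trmxK -(mulmxA T^T) mxtrace_mulC.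
set Y := T *m W *m T^T in psdY *.
have WE : W = T' *m Y *m T'^T.
  by rewrite /Y !mulmxA T'T mul1mx -mulmxA -trmx_mul T'T trmx1 mulmx1.
have tr0 : 0 <= \tr Y.
  rewrite /mxtrace sumr_ge0// => l _.
  by rewrite -inner_delta; exact: psdY.2.
rewrite {1}WE mxE; apply: (le_trans (ler_norm_sum _ _ _)).
apply: (@le_trans _ _ (\sum_b c * \tr Y * `|T' j b|)).
  apply: ler_sum => b _; rewrite !mxE normrM ler_wpM2r//.
  apply: (le_trans (ler_norm_sum _ _ _)).
  apply: (@le_trans _ _ (\sum_a `|T' i a| * \tr Y)).
    by apply: ler_sum => a _; rewrite normrM ler_wpM2l// possemidef_entry.
  by rewrite -mulr_suml ler_wpM2r.
by rewrite -mulr_sumr [leRHS]mulrAC ler_wpM2l// mulr_ge0.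
Qed.

Lemma posdef_linv m n (X : 'M[R]_(m, n)) : posdef (X^T *m X) ->
  exists X' : 'M[R]_(n, m), X' *m X = 1%:M.
Proof.
move=> [sG G0]; exists (invmx (X^T *m X) *m X^T); rewrite -mulmxA mulVmx//.
rewrite unitmxE unitfE; apply/negP => /eqP d0.
have /det0P[w w0 wG] : \det (X^T *m X) == 0 by rewrite d0.
have := G0 w^T; rewrite trmx_eq0 => /(_ w0).
rewrite -sG -trmx_mul wG trmx0 /inner big1 ?ltxx// => i _.
by rewrite !mxE mulr0.
Qed.

End Semidefinite.

(** * The value function of the relaxed problem *)

Section ValueFunction.
Context {R : realType} {t : nat} (ns : 'I_t -> nat) {m l q M : nat}.
Local Notation n := (\sum_j ns j)%N.
Context (B1 : 'M[R]_(n, l)) (C : 'M[R]_(q, n)) (D : 'M[R]_(q, m)).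
Context (F : 'I_M -> 'M[R]_(n + m)).
Implicit Types (x y : 'cV[R]_(n * m)) (W : 'cV[R]_((n + m) * (n + m))).

Local Notation phi1 := (phi1hat B1 C D F).
Local Notation cost W := (inner (vec (Rmx C D)) W).

Definition lmi_feasible W :=
  Gamma_plus (n + m) W /\ forall i, Gamma_plus n (Psi B1 (F i) (unvec W)).

Definition feasible x W := Acal ns m *m W = Umx ns m *m x /\ lmi_feasible W.

Lemma fobj_feasible W : lmi_feasible W -> fobj B1 C D F W = (cost W)%:E.
Proof.
move=> [W0 P0]; rewrite /fobj /delta asboolT// adde0.
rewrite [X in (_ + X)%E](_ : _ = 0%E) ?adde0//.
by apply: big1 => i _; rewrite asboolT.
Qed.

Lemma fobj_lty W : (fobj B1 C D F W < +oo)%E -> lmi_feasible W.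
Proof.
have d0 (T : Type) (A : set T) a : (0 <= @delta R T A a)%E.
  by rewrite /delta; case: ifP => _; rewrite ?leey.
have dinf (T : Type) (A : set T) a : ~ A a -> @delta R T A a = +oo%E.
  by move=> nA; rewrite /delta asboolF.
have sum_ge0 (P : pred 'I_M) :
    (0 <= \sum_(i < M | P i) @delta R _ (Gamma_plus n) (Psi B1 (F i) (unvec W)))%E.
  by apply: sume_ge0 => i _; exact: d0.
rewrite /fobj => fin; split.
  apply: contrapT => nW; have E := dinf _ _ _ nW; move: fin.
  by rewrite E addey// addye ?ltxx// -ltNye (lt_le_trans _ (sum_ge0 _)).
move=> i; apply: contrapT => nW; have E := dinf _ _ _ nW; move: fin.
rewrite [X in (_ + X)%E](_ : _ = +oo%E); last first.
  by apply/eqP; rewrite (bigD1 i)//= E addye// -ltNye (lt_le_trans _ (sum_ge0 _)).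
rewrite addey ?ltxx// -ltNye (@lt_le_trans _ _ (cost W)%:E) ?ltNyr//.
by rewrite leeDl.
Qed.

Lemma value_le x W : feasible x W -> (phi1 x <= (cost W)%:E)%E.
Proof.
by move=> [eqW lmiW]; apply: ereal_inf_lbound; exists W => //; rewrite fobj_feasible.
Qed.

Lemma value_lt x a : (phi1 x < a%:E)%E -> exists2 W, feasible x W & cost W < a.
Proof.
move=> /ereal_inf_lt[_ [W /= eqW <-]] lta.
have lmiW : lmi_feasible W by apply: fobj_lty; rewrite (lt_trans lta) ?ltry.
by exists W => //; rewrite -lte_fin -fobj_feasible.
Qed.

Lemma Psi_affine (G W1 W2 : 'M[R]_(n + m)) s :
  Psi B1 G ((1 - s) *: W1 + s *: W2) = (1 - s) *: Psi B1 G W1 + s *: Psi B1 G W2.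
Proof.
rewrite /Psi -!vecZ -vecD; congr vec.
set q1 := Qmx m B1.
have -> : G *m ((1 - s) *: W1 + s *: W2) + ((1 - s) *: W1 + s *: W2) *m G^T + q1 =
  (1 - s) *: (G *m W1 + W1 *m G^T + q1) + s *: (G *m W2 + W2 *m G^T + q1).
  rewrite mulmxDr mulmxDl -!scalemxAl -!scalemxAr.
  by apply/matrixP => i j; rewrite !mxE; ring.
move: (G *m W1 + _ + _) (G *m W2 + _ + _) => X1 X2.
by rewrite mulmxDr mulmxDl -!scalemxAr -!scalemxAl opprD !scalerN.
Qed.

Lemma feasible_convex x y W1 W2 s : 0 <= s <= 1 ->
  feasible x W1 -> feasible y W2 ->
  feasible ((1 - s) *: x + s *: y) ((1 - s) *: W1 + s *: W2).
Proof.
move=> s01 [e1 [w1 p1]] [e2 [w2 p2]]; split; last split.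
- by rewrite !mulmxDr -!scalemxAr e1 e2.
- exact: Gamma_plus_convex.
- by move=> i; rewrite unvecD !unvecZ Psi_affine; exact: Gamma_plus_convex.
Qed.

(** A partial minimization of a jointly convex problem. The infimum need not be
    attained, hence the near-minimizers. *)
Lemma value_convex : convex_epi phi1.
Proof.
move=> x y a b s xa yb s01; apply/lee_addgt0Pr => e e0.
have lt z c : (phi1 z <= c%:E)%E -> exists2 W, feasible z W & cost W < c + e.
  by move=> zc; apply: value_lt; rewrite (le_lt_trans zc)// lte_fin ltrDl.
have [[W1 f1 c1] [W2 f2 c2]] := (lt x a xa, lt y b yb).
apply: (le_trans (value_le (feasible_convex s01 f1 f2))).
rewrite -EFinD lee_fin innerDr !innerZr.
have /andP[s0 s1] := s01; rewrite -subr_ge0 in s1.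
have := ler_wpM2l s1 (ltW c1); have := ler_wpM2l s0 (ltW c2).
by lra.
Qed.

(** The last rows of the linear constraint say that [x] is the vectorized lower
    left block of the matrix. *)
Lemma feasible_entry x W (i : 'I_m) (j : 'I_n) : feasible x W ->
  x (mxtens_index (j, i)) 0 = unvec W (rshift n i) (lshift m j).
Proof.
move=> [+ _]; rewrite /Acal /Umx !mul_col_mx mul0mx mul1mx => /eq_col_mx[_ <-].
rewrite -[W in LHS]unvecK -[V2 n m in LHS]trmxK -vec_mulmx mxE mxtens_indexK/=.
rewrite -[unvec W in LHS]submxK /V1 /V2 tr_row_mx trmx1 trmx0.
rewrite mul_row_block mul_row_col !mul0mx !mul1mx !mulmx1 !mulmx0.
by rewrite add0r addr0 !mxE.
Qed.

(** The cost matrix is [T^T T] with [T] the block diagonal matrix of [C] and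
    [D], and the entries of [x] are among those of the feasible matrices. *)
Lemma value_coercive : posdef (C^T *m C) -> posdef (D^T *m D) ->
  exists2 K, 0 < K & forall x a, (phi1 x <= a%:E)%E -> enorm x <= K * a.
Proof.
move=> /posdef_linv[C' C'C] /posdef_linv[D' D'D].
pose T := block_mx C 0 0 D; pose T' := block_mx C' 0 0 D'.
have T'T : T' *m T = 1%:M.
  rewrite mulmx_block !mul0mx !mulmx0 !addr0 !add0r C'C D'D.
  by rewrite scalar_mx_block.
have RT : Rmx C D = T^T *m T.
  by rewrite tr_block_mx !trmx0 mulmx_block !mul0mx !mulmx0 !addr0 !add0r.
have [c c0 cW] := trace_coercive T'T.
pose N : R := (n * m)%:R * c.
have N0 : 0 <= N by rewrite mulr_ge0.
have bnd x W : feasible x W -> enorm x <= N * cost W.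
  move=> fW; have [_ [[X psdX XW] _]] := fW.
  apply: (le_trans (enorm_le_sum _)).
  apply: (@le_trans _ _ (\sum_(i < n * m) c * cost W)).
    apply: ler_sum => i _; case: (mxtens_indexP i) => j i'.
    by rewrite (feasible_entry _ _ fW) -XW vecK RT cW.
  by rewrite sumr_const card_ord -[leLHS]mulr_natl mulrA.
exists (N + 1); first by rewrite ltr_wpDl.
move=> x a xa; apply/ler_addgt0Pr => e e0.
have [|W fW Wa] := @value_lt x (a + e / (N + 1)).
  by rewrite (le_lt_trans xa)// lte_fin ltrDl divr_gt0// ltr_wpDl.
have W0 : 0 <= cost W.
  have [_ [[X psdX <-] _]] := fW.
  rewrite RT inner_vec trmx_mul trmxK -(mulmxA T^T) mxtrace_mulC /mxtrace sumr_ge0// => i _.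
  by rewrite -inner_delta; exact: (possemidef_congr T psdX).2.
apply: (le_trans (bnd _ _ fW)).
apply: (@le_trans _ _ ((N + 1) * cost W)).
  by rewrite ler_wpM2r// lerDl.
have N1 : 0 < N + 1 by rewrite ltr_wpDl.
rewrite -(ltr_pM2l N1) mulrDr (mulrC (N + 1) (e / _)) divfK ?lt0r_neq0// in Wa.
exact: ltW.
Qed.

End ValueFunction.

(** * The block penalty *)

Section BlockPenalty.
Context {R : realType} {s t : nat} (ms : 'I_s -> nat) (ns : 'I_t -> nat).
Local Notation n := (\sum_j ns j)%N.
Local Notation m := (\sum_i ms i)%N.

(** The position in [pi_blocks] of the block that contains a coordinate. *)
Definition block_label (k : 'I_(n * m)) : 'I_(t * s) :=
  let ji := mxtens_unindex k in
  mxtens_index (tagnat.sig1 ji.1, tagnat.sig1 ji.2).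

Lemma phi2hatE (gamma : R) : phi2hat gamma = sparsity block_label gamma.
Proof.
apply/funext => x; rewrite /phi2hat /sparsity /l0norm.
congr (_ * _%:R)%:E; apply: eq_card => p; rewrite inE.
case: (mxtens_indexP p) => j i; rewrite !mxE mxtens_indexK/= pnatr_eq0 eqb0 negbK.
apply/idP/patternP => [xij|[k]].
  have /existsP[a /existsP[c xac]] :
      [exists a, exists c, submxblock (unvec x) i j a c != 0].
    apply: contraNT xij; rewrite negb_exists => /forallP x0.
    apply/eqP/matrixP => a c; rewrite [RHS]mxE.
    by have := x0 a; rewrite negb_exists => /forallP/(_ c); rewrite negbK => /eqP.
  exists (mxtens_index (tagnat.Rank j c, tagnat.Rank i a)).
    by rewrite /block_label mxtens_indexK/= !tagnat.Rank1K.
  by move: xac; rewrite !mxE.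
case: (mxtens_indexP k) => j' i'; rewrite /block_label mxtens_indexK/=.
move=> /(can_inj (@mxtens_indexK _ _))[<- <-] xk.
apply: contraNneq xk => /matrixP/(_ (tagnat.sig2 i') (tagnat.sig2 j')).
by rewrite !mxE !tagnat.sig2K => ->.
Qed.

End BlockPenalty.

Theorem theorem2 (R : realType) (s t l q M : nat)
  (ms : 'I_s -> nat) (ns : 'I_t -> nat)
  (A : 'M[R]_(\sum_j ns j)%N)
  (B2 : 'M[R]_((\sum_j ns j)%N, (\sum_i ms i)%N))
  (B1 : 'M[R]_((\sum_j ns j)%N, l))
  (C : 'M[R]_(q, (\sum_j ns j)%N))
  (D : 'M[R]_(q, (\sum_i ms i)%N))
  (Av : 'I_M -> 'M[R]_(\sum_j ns j)%N)
  (B2v : 'I_M -> 'M[R]_((\sum_j ns j)%N, (\sum_i ms i)%N))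
  (gamma eta xi L : R)
  (u v s2 : nat -> 'cV[R]_((\sum_j ns j) * (\sum_i ms i)))
  (S : set 'cV[R]_((\sum_j ns j) * (\sum_i ms i))) :
  let F := fun i : 'I_M => Fmx (Av i) (B2v i) in
  let phi1 := phi1hat B1 C D F in
  let phi2 := phi2hat gamma in
  let zeta := fun x => (phi1 x + phi2 x)%E in
  standing_assumption1 A B2 B1 C D ->
  standing_assumption2 A B2 F ->
  0 < gamma -> 0 < eta -> 0 < xi -> 0 < L ->
  DR_iterates eta xi phi1 phi2 u v s2 ->
  closed S -> convex_set S -> S `<=` edom phi1 ->
  (forall k, S (u k)) -> (forall k, S (s2 k)) ->
  Lsmooth_on L phi1 S ->
  xi < 2 ->
  eta < Num.min ((2 - xi) / (2 * L)) (1 / L) ->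
  exists u' : 'cV[R]_((\sum_j ns j) * (\sum_i ms i)),
    [/\ u k @[k --> \oo] --> u', v k @[k --> \oo] --> u' &
        lim_subdiff zeta u' 0].
Proof.
move=> F phi1 phi2 zeta [_ [DD CC _] _ _] _ gamma0 eta0 xi0 L0 DR clS _ _ uS _ smooth xi2.
rewrite lt_min ltr_pdivlMr ?mulr_gt0// ltr_pdivlMr// => /andP[etaxi etaL].
have [K K0 coer] := value_coercive B1 F CC DD.
rewrite /zeta; move: DR; rewrite /phi2 phi2hatE => DR.
apply: (DR_sparsity_cvg eta0 xi0 xi2 gamma0 L0 K0 etaL _ _ coer clS uS smooth DR).
  by rewrite mulrCA.
exact: value_convex.
Qed.
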